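(* There exists a constant $K_{11}>0$, depending only on $\gamma$, $\|f\|$ and $L$, such that the following holds. If $m\in\mathbb{N}$ satisfies $$m\ \geq\ \frac{L}{2\pi}K_{11}-1,$$ then the projection $P_m$ is determining for the damped driven NLS: whenever $u_1,u_2:\mathbb{R}\to H^2_{per}$ are two complete trajectories lying in the global attractor $\mathcal{A}$ and $P_m u_1(t)=P_m u_2(t)$ for all $t\in\mathbb{R}$, then $u_1(t)=u_2(t)$ for all $t\in\mathbb{R}$.
   Context: Fix $0<L<\infty$, $\gamma>0$ and a time-independent $f\in L^2_{per}[0,L]$, $f\neq 0$. The damped driven nonlinear Schrödinger equation (NLS) is $$iu_t+u_{xx}+|u|^2u+i\gamma u=f,\qquad u(t,x)=u(t,x+L),$$ with complex-valued $u$. $H^k_{per}$ denotes the $L$-periodic Sobolev space of order $k$; $\|\cdot\|$ is the $L^2(0,L)$ norm, $\|u\|_{H^1}^2=\|u\|^2+\|u_x\|^2$, $\|u\|_{H^2}^2=\|u\|^2+\|u_{xx}\|^2$. The NLS generates a solution semigroup on $H^2_{per}$ possessing a global attractor $\mathcal{A}\subset H^2_{per}$ (the maximal compact invariant set); a complete trajectory in $\mathcal{A}$ is a solution $u:\mathbb{R}\to H^2_{per}$ of the NLS defined for all $t\in\mathbb{R}$ with $u(t)\in\mathcal{A}$ for all $t$. For $m\in\mathbb{N}$, $P_m$ denotes the $L^2$-orthogonal projection onto $H_m=\mathrm{span}\{e^{2\pi ikx/L}: |k|\le m\}$. *)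

(* Defs.v *)
(* L-periodic functions are represented by
   their Fourier coefficients w.r.t. e_k(x) = exp(2 pi i k x / L), k in Z:
   u = sum_k c k e_k.  Complex numbers are pairs (Re, Im). *)
From Stdlib Require Import Reals ZArith.
Open Scope R_scope.

Definition C := (R * R)%type.
Definition Cadd (z w : C) : C := (fst z + fst w, snd z + snd w).
Definition Csub (z w : C) : C := (fst z - fst w, snd z - snd w).
Definition Cmul (z w : C) : C :=
  (fst z * fst w - snd z * snd w, fst z * snd w + snd z * fst w).
Definition Cconj (z : C) : C := (fst z, - snd z).
Definition Cnorm2 (z : C) : R := fst z ^ 2 + snd z ^ 2.
Definition Ci : C := (0, 1).
Definition RtoC (r : R) : C := (r, 0).

Definition coef := Z -> C.

Definition sumZ (n : nat) (g : Z -> R) : R :=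
  sum_f_R0 (fun j => g (Z.of_nat j - Z.of_nat n)%Z) (2 * n).

Definition freq (L : R) (k : Z) : R := 2 * PI * IZR k / L.

(* ||u||^2 = L sum |c_k|^2 ;  ||u||_{H^2}^2 = ||u||^2 + ||u_xx||^2
   = L sum (1 + (2 pi k/L)^4) |c_k|^2 *)
Definition wH2 (L : R) (k : Z) : R := 1 + freq L k ^ 4.

Definition L2_partial (L : R) (c : coef) (n : nat) : R :=
  L * sumZ n (fun k => Cnorm2 (c k)).
Definition H2_partial (L : R) (c : coef) (n : nat) : R :=
  L * sumZ n (fun k => wH2 L k * Cnorm2 (c k)).

Definition in_L2 (L : R) (c : coef) : Prop :=
  exists B, forall n, L2_partial L c n <= B.
Definition in_H2 (L : R) (c : coef) : Prop :=
  exists B, forall n, H2_partial L c n <= B.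

Definition L2_norm_is (L : R) (c : coef) (nf : R) : Prop :=
  0 <= nf /\ Un_cv (L2_partial L c) (nf ^ 2).

Definition H2_distsq_le (L : R) (a b : coef) (eps : R) : Prop :=
  forall n, H2_partial L (fun k => Csub (a k) (b k)) n <= eps.

Definition H2_conv (L : R) (s : nat -> coef) (a : coef) : Prop :=
  forall eps, 0 < eps -> exists N, forall n, (N <= n)%nat -> H2_distsq_le L (s n) a eps.

Definition Pm_eq (m : nat) (a b : coef) : Prop :=
  forall k : Z, (Z.abs k <= Z.of_nat m)%Z -> a k = b k.

(* (|u|^2 u)^_k = sum_{k1,k2} c_{k1} conj(c_{k2}) c_{k-k1+k2}, as limit of
   square partial sums (absolutely convergent for H^2 data). *)
Definition cubic_term (c : coef) (k k1 k2 : Z) : C :=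
  Cmul (Cmul (c k1) (Cconj (c k2))) (c (k - k1 + k2)%Z).
Definition cubic_coef (c : coef) (k : Z) (z : C) : Prop :=
  Un_cv (fun n => sumZ n (fun k1 => sumZ n (fun k2 => fst (cubic_term c k k1 k2)))) (fst z)
  /\ Un_cv (fun n => sumZ n (fun k1 => sumZ n (fun k2 => snd (cubic_term c k k1 k2)))) (snd z).

(* Mode k of  i u_t + u_xx + |u|^2 u + i gamma u = f :
   i d - (2 pi k/L)^2 c_k + N_k + i gamma c_k = f_k *)
Definition nls_mode (L gamma : R) (f : coef) (c : coef) (k : Z) (d z : C) : Prop :=
  Cadd (Cadd (Cadd (Cmul Ci d) (Cmul (RtoC (- freq L k ^ 2)) (c k))) z)
       (Cmul (RtoC gamma) (Cmul Ci (c k))) = f k.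

Definition nls_sol_on (L gamma : R) (f : coef) (a b : R) (u : R -> coef) : Prop :=
  a <= b /\
  (forall t, a <= t <= b -> in_H2 L (u t)) /\
  (forall t, a <= t <= b -> forall eps, 0 < eps -> exists delta, 0 < delta /\
     forall s, a <= s <= b -> Rabs (s - t) < delta -> H2_distsq_le L (u s) (u t) eps) /\
  (forall t, a < t < b -> forall k : Z, exists d z : C,
     derivable_pt_lim (fun s => fst (u s k)) t (fst d) /\
     derivable_pt_lim (fun s => snd (u s k)) t (snd d) /\
     cubic_coef (u t) k z /\ nls_mode L gamma f (u t) k d z).

Definition nls_complete_sol (L gamma : R) (f : coef) (u : R -> coef) : Prop :=
  forall T, 0 < T -> nls_sol_on L gamma f (- T) T u.

Definition nls_S (L gamma : R) (f : coef) (t : R) (a b : coef) : Prop :=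
  exists u, nls_sol_on L gamma f 0 t u /\ u 0 = a /\ u t = b.

Definition H2_compact (L : R) (A : coef -> Prop) : Prop :=
  (forall a, A a -> in_H2 L a) /\
  (forall s : nat -> coef, (forall n, A (s n)) ->
     exists (phi : nat -> nat) (a : coef),
       (forall n, (phi n < phi (S n))%nat) /\ A a /\ H2_conv L (fun n => s (phi n)) a).

Definition nls_invariant (L gamma : R) (f : coef) (A : coef -> Prop) : Prop :=
  forall t, 0 <= t ->
    (forall a b, A a -> nls_S L gamma f t a b -> A b) /\
    (forall b, A b -> exists a, A a /\ nls_S L gamma f t a b).

Definition nls_global_attractor (L gamma : R) (f : coef) (A : coef -> Prop) : Prop :=
  H2_compact L A /\ nls_invariant L gamma f A /\
  (forall B, H2_compact L B -> nls_invariant L gamma f B -> forall a, B a -> A a).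

Definition complete_traj_in (L gamma : R) (f : coef) (A : coef -> Prop) (u : R -> coef) : Prop :=
  nls_complete_sol L gamma f u /\ forall t, A (u t).

(* Main.v *)
From Stdlib Require Import Reals ZArith Lra Lia Psatz ClassicalEpsilon FunctionalExtensionality.
Require Import Defs.
Open Scope R_scope.

(** The obstacle is that the NLS does not smooth and its damping has order zero. In the balance of
    |w|^2 the term Im of the mean of v^2 conj(w)^2 has the same order as gamma |w|^2, so restricting
    w to high frequencies gains nothing there. One derivative higher the interaction terms are of
    lower order than |w_x|^2, and only then does a large m help. The Hamiltonian form makes this
    level accessible: i (w' + gamma w) = h with h a difference of gradients, so the part -i h of w'
    is orthogonal to h and only -gamma times the pairing of h with w remains.

    The second constraint is that the threshold may depend only on gamma, |f| and L, whereas the H^2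
    bound comes from compactness and depends on the attractor. Since v_t contains v_xx, one
    derivative has to be moved onto the other factors, so that only H^1 bounds occur. The H^2 bound
    itself survives only as a factor of the defect e, which is sent to 0 after m is fixed, and in
    the a priori upper bounds, which the whole-line argument discards. *)

(* The attractor is bounded in H^2, so for every complete trajectory u in it the truncation P_n u
   solves the Galerkin system up to an error tending to 0 in L^2 uniformly in time.  Every
   energy identity is therefore a finite-dimensional one with a small defect, and on the whole
   line F' <= -a F + b with F bounded above forces F <= b/a.  Applied to the mass and to the
   Hamiltonian this bounds u in H^1 in terms of gamma, |f|, L only.  For w = u - v with P_m w = 0
   it is applied to E = 1/2 |w_x|^2 - K, where K is the second-order Taylor remainder of
   1/4 |u|^4 at v: E' involves v_t only through terms quadratic in w, and as
   sum_k |w_k| <= C m^(-1/2) |w_x| these are dominated by gamma |w_x|^2 for large m.  Hence E <= 0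
   in the limit n -> oo, and w = 0. *)

(** * Symmetric finite sums over the integers *)

Lemma sumZ_0 (g : Z -> R) : sumZ 0 g = g 0%Z.
Proof. reflexivity. Qed.

(** Peeling off the modes n + 1 and -(n + 1) together is what allows most later facts to be proved
    by induction on n, without reindexing. *)
Lemma sumZ_S (n : nat) (g : Z -> R) :
  sumZ (S n) g = sumZ n g + g (Z.of_nat (S n)) + g (- Z.of_nat (S n))%Z.
Proof.
  unfold sumZ.
  replace (2 * S n)%nat with (S (S (2 * n))) by lia.
  rewrite decomp_sum by lia.
  replace (pred (S (S (2 * n)))) with (S (2 * n)) by lia.
  rewrite tech5.
  replace (Z.of_nat 0 - Z.of_nat (S n))%Z with (- Z.of_nat (S n))%Z by lia.
  replace (Z.of_nat (S (S (2 * n))) - Z.of_nat (S n))%Z with (Z.of_nat (S n)) by lia.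
  rewrite (sum_eq (fun i => g (Z.of_nat (S i) - Z.of_nat (S n))%Z)
             (fun j => g (Z.of_nat j - Z.of_nat n)%Z)); [ring|].
  intros i _. f_equal. lia.
Qed.

Lemma sumZ_ext (n : nat) (g h : Z -> R) :
  (forall k, (Z.abs k <= Z.of_nat n)%Z -> g k = h k) -> sumZ n g = sumZ n h.
Proof. intros H. apply sum_eq. intros i Hi. apply H. lia. Qed.

Lemma sumZ_le (n : nat) (g h : Z -> R) :
  (forall k, (Z.abs k <= Z.of_nat n)%Z -> g k <= h k) -> sumZ n g <= sumZ n h.
Proof. intros H. apply sum_Rle. intros i Hi. apply H. lia. Qed.

Lemma sumZ_zero (n : nat) : sumZ n (fun _ => 0) = 0.
Proof. induction n; [reflexivity|]. rewrite sumZ_S, IHn. ring. Qed.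

Lemma sumZ_nonneg (n : nat) (g : Z -> R) : (forall k, 0 <= g k) -> 0 <= sumZ n g.
Proof. intros H. rewrite <- (sumZ_zero n). apply sumZ_le. auto. Qed.

Lemma sumZ_plus (n : nat) (g h : Z -> R) :
  sumZ n (fun k => g k + h k) = sumZ n g + sumZ n h.
Proof. induction n; [reflexivity|]. rewrite !sumZ_S, IHn. ring. Qed.

Lemma sumZ_scal (n : nat) (x : R) (g : Z -> R) :
  sumZ n (fun k => x * g k) = x * sumZ n g.
Proof. induction n; [reflexivity|]. rewrite !sumZ_S, IHn. ring. Qed.

Lemma sumZ_abs (n : nat) (g : Z -> R) : Rabs (sumZ n g) <= sumZ n (fun k => Rabs (g k)).
Proof.
  induction n; [apply Rle_refl|]. rewrite !sumZ_S.
  eapply Rle_trans; [apply Rabs_triang|]. apply Rplus_le_compat_r.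
  eapply Rle_trans; [apply Rabs_triang|]. apply Rplus_le_compat_r. exact IHn.
Qed.

Lemma sumZ_exchange (n m : nat) (g : Z -> Z -> R) :
  sumZ n (fun i => sumZ m (fun j => g i j)) = sumZ m (fun j => sumZ n (fun i => g i j)).
Proof.
  induction n; [reflexivity|].
  rewrite sumZ_S, IHn, <- !sumZ_plus.
  apply sumZ_ext. intros k _. rewrite sumZ_S. reflexivity.
Qed.

Lemma sumZ_mono (n m : nat) (g : Z -> R) :
  (forall k, 0 <= g k) -> (n <= m)%nat -> sumZ n g <= sumZ m g.
Proof.
  intros H Hnm. induction Hnm; [apply Rle_refl|].
  rewrite sumZ_S. pose proof (H (Z.of_nat (S m))). pose proof (H (- Z.of_nat (S m))%Z). lra.
Qed.

Lemma sumZ_term (n : nat) (g : Z -> R) (k : Z) :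
  (forall j, 0 <= g j) -> (Z.abs k <= Z.of_nat n)%Z -> g k <= sumZ n g.
Proof.
  intros H Hk. induction n.
  - assert (k = 0%Z) by lia. subst. apply Rle_refl.
  - rewrite sumZ_S.
    pose proof (H (Z.of_nat (S n))). pose proof (H (- Z.of_nat (S n))%Z).
    pose proof (sumZ_nonneg n g H).
    destruct (Z_le_gt_dec (Z.abs k) (Z.of_nat n)) as [h|h].
    + specialize (IHn h). lra.
    + assert (k = Z.of_nat (S n) \/ k = - Z.of_nat (S n))%Z as [->| ->] by lia; lra.
Qed.

Lemma sumZ_support (n m : nat) (g : Z -> R) :
  (n <= m)%nat -> (forall k, (Z.of_nat n < Z.abs k)%Z -> g k = 0) -> sumZ m g = sumZ n g.
Proof.
  intros Hnm H. induction Hnm; [reflexivity|].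
  rewrite sumZ_S, IHHnm, !H by lia. ring.
Qed.

Lemma sumZ_single (n : nat) (a : Z) (x : R) :
  sumZ n (fun k => if (k =? a)%Z then x else 0) = if (Z.abs a <=? Z.of_nat n)%Z then x else 0.
Proof.
  induction n.
  - rewrite sumZ_0. destruct (Z.eqb_spec 0 a), (Z.leb_spec (Z.abs a) (Z.of_nat 0)); auto; lia.
  - rewrite sumZ_S, IHn.
    destruct (Z.eqb_spec (Z.of_nat (S n)) a), (Z.eqb_spec (- Z.of_nat (S n)) a),
      (Z.leb_spec (Z.abs a) (Z.of_nat n)), (Z.leb_spec (Z.abs a) (Z.of_nat (S n)));
      try lia; ring.
Qed.

Lemma sumZ_const (n : nat) (x : R) : sumZ n (fun _ => x) = (2 * INR n + 1) * x.
Proof.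
  induction n; [rewrite sumZ_0; simpl; ring|].
  rewrite sumZ_S, IHn, S_INR. ring.
Qed.

Lemma sumZ_derivable (n : nat) (F : R -> Z -> R) (dF : Z -> R) (t : R) :
  (forall k, (Z.abs k <= Z.of_nat n)%Z -> derivable_pt_lim (fun s => F s k) t (dF k)) ->
  derivable_pt_lim (fun s => sumZ n (F s)) t (sumZ n dF).
Proof.
  induction n; intros H.
  - apply H. lia.
  - rewrite sumZ_S.
    assert (E : forall (f g : R -> R) l, (forall s, f s = g s) ->
              derivable_pt_lim g t l -> derivable_pt_lim f t l).
    { intros f g l He Hd eps Heps. destruct (Hd eps Heps) as [dl Hdl]. exists dl.
      intros h Hh0 Hh. rewrite !He. auto. }
    eapply E; [intros s; apply sumZ_S|].
    apply (derivable_pt_lim_plus (fun s => sumZ n (F s) + F s (Z.of_nat (S n)))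
             (fun s => F s (- Z.of_nat (S n))%Z)); [|apply H; lia].
    apply (derivable_pt_lim_plus (fun s => sumZ n (F s)) (fun s => F s (Z.of_nat (S n))));
      [|apply H; lia].
    apply IHn. intros k Hk. apply H. lia.
Qed.

(** * Norms *)

Definition l2 (n : nat) (a : Z -> R) : R := sqrt (sumZ n (fun k => a k ^ 2)).

Lemma sumZ_sq_nonneg (n : nat) (a : Z -> R) : 0 <= sumZ n (fun k => a k ^ 2).
Proof. apply sumZ_nonneg. intros. apply pow2_ge_0. Qed.

Lemma l2_nonneg (n : nat) (a : Z -> R) : 0 <= l2 n a.
Proof. apply sqrt_pos. Qed.

Lemma l2_sq (n : nat) (a : Z -> R) : l2 n a ^ 2 = sumZ n (fun k => a k ^ 2).
Proof. apply pow2_sqrt, sumZ_sq_nonneg. Qed.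

(** Converse of Young's inequality, by optimising in s: for positive A, B take s = B / A. If A or B
    vanishes, a value of s that leaves at most P on the right contradicts P > 0. *)
Lemma le_mul_of_young (P A B : R) :
  0 <= A -> 0 <= B -> (forall s, 0 < s -> 2 * P <= s * A ^ 2 + B ^ 2 / s) -> P <= A * B.
Proof.
  intros HA HB H.
  destruct (Rle_lt_dec P 0) as [h|h]; [assert (0 <= A * B) by (apply Rmult_le_pos; lra); lra|].
  destruct HA as [HA|<-].
  2:{ specialize (H ((B ^ 2 + 1) / P)). assert (0 < B ^ 2 + 1) by nra.
      assert (H1 : 0 < (B ^ 2 + 1) / P) by (apply Rdiv_lt_0_compat; lra).
      specialize (H H1).
      replace (B ^ 2 / ((B ^ 2 + 1) / P)) with (P * (B ^ 2 / (B ^ 2 + 1))) in H by (field; repeat split; nra).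
      assert (B ^ 2 / (B ^ 2 + 1) <= 1).
      { apply Rmult_le_reg_r with (B ^ 2 + 1); [lra|].
        unfold Rdiv. rewrite Rmult_assoc, Rinv_l by lra. lra. }
      nra. }
  destruct HB as [HB|<-].
  2:{ specialize (H (P / A ^ 2)). assert (0 < A ^ 2) by nra.
      assert (H1 : 0 < P / A ^ 2) by (apply Rdiv_lt_0_compat; lra).
      specialize (H H1).
      replace (P / A ^ 2 * A ^ 2 + 0 ^ 2 / (P / A ^ 2)) with P in H by (field; repeat split; nra).
      lra. }
  specialize (H (B / A)). assert (H1 : 0 < B / A) by (apply Rdiv_lt_0_compat; lra).
  specialize (H H1).
  replace (B / A * A ^ 2 + B ^ 2 / (B / A)) with (2 * (A * B)) in H by (field; repeat split; nra).
  lra.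
Qed.

Lemma young (s a b : R) : 0 < s -> 2 * (a * b) <= s * a ^ 2 + b ^ 2 / s.
Proof.
  intros Hs. apply Rmult_le_reg_l with s; [lra|].
  replace (s * (s * a ^ 2 + b ^ 2 / s)) with (s ^ 2 * a ^ 2 + b ^ 2) by (field; repeat split; nra).
  pose proof (pow2_ge_0 (s * a - b)). nra.
Qed.

(** Schur test: weighted Young on each term, then the row sums are used against a^2 and the column
    sums against b^2. It serves twice, for the identity kernel (Cauchy-Schwarz) and for the kernel
    [resonance] (multilinear estimates). *)
Lemma schur (n : nat) (D : Z -> Z -> R) (a b : Z -> R) :
  (forall k l, 0 <= D k l) ->
  (forall k, sumZ n (fun l => D k l) <= 1) ->
  (forall l, sumZ n (fun k => D k l) <= 1) ->
  sumZ n (fun k => sumZ n (fun l => D k l * (a k * b l))) <= l2 n a * l2 n b.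
Proof.
  intros HD H1 H2. apply le_mul_of_young; try apply l2_nonneg. intros s Hs.
  rewrite !l2_sq. unfold Rdiv.
  apply Rle_trans with
    (sumZ n (fun k => s * a k ^ 2 * sumZ n (fun l => D k l))
     + sumZ n (fun l => / s * b l ^ 2 * sumZ n (fun k => D k l))).
  - rewrite (sumZ_ext n (fun l => / s * b l ^ 2 * sumZ n (fun k => D k l))
               (fun l => sumZ n (fun k => / s * b l ^ 2 * D k l)))
      by (intros; symmetry; apply sumZ_scal).
    rewrite (sumZ_exchange n n (fun l k => / s * b l ^ 2 * D k l)), <- sumZ_plus, <- sumZ_scal.
    apply sumZ_le. intros k _. rewrite <- !sumZ_scal, <- sumZ_plus.
    apply sumZ_le. intros l _.
    pose proof (young s (a k) (b l) Hs). unfold Rdiv in H. specialize (HD k l). nra.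
  - rewrite <- sumZ_scal, (Rmult_comm _ (/ s)), <- sumZ_scal.
    assert (0 < / s) by (apply Rinv_0_lt_compat; lra).
    apply Rplus_le_compat; apply sumZ_le; intros k _.
    + pose proof (Rmult_le_compat_l _ _ _ (Rmult_le_pos _ _ (Rlt_le _ _ Hs) (pow2_ge_0 (a k))) (H1 k)).
      lra.
    + pose proof (Rmult_le_compat_l _ _ _ (Rmult_le_pos _ _ (Rlt_le _ _ H) (pow2_ge_0 (b k))) (H2 k)).
      lra.
Qed.

Lemma sumZ_cauchy_schwarz (n : nat) (a b : Z -> R) :
  sumZ n (fun k => a k * b k) <= l2 n a * l2 n b.
Proof.
  rewrite (sumZ_ext n _ (fun k => sumZ n (fun l => (if (l =? k)%Z then 1 else 0) * (a k * b l)))).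
  - apply schur; intros; try (destruct Z.eqb; lra).
    + rewrite sumZ_single. destruct Z.leb; lra.
    + rewrite (sumZ_ext n _ (fun k => if (k =? l)%Z then 1 else 0)).
      * rewrite sumZ_single. destruct Z.leb; lra.
      * intros k _. rewrite Z.eqb_sym. reflexivity.
  - intros k Hk. rewrite (sumZ_ext n _ (fun l => if (l =? k)%Z then a k * b k else 0)).
    + rewrite sumZ_single. destruct (Z.leb_spec (Z.abs k) (Z.of_nat n)); [reflexivity|lia].
    + intros l _. destruct (Z.eqb_spec l k); [subst|]; ring.
Qed.

Lemma l2_le_l1 (n : nat) (a : Z -> R) : (forall k, 0 <= a k) -> l2 n a <= sumZ n a.
Proof.
  intros H. pose proof (sumZ_nonneg n a H).
  apply Rsqr_incr_0; [|apply l2_nonneg|assumption].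
  rewrite !Rsqr_pow2, l2_sq.
  replace (sumZ n a ^ 2) with (sumZ n a * sumZ n a) by ring.
  rewrite <- sumZ_scal. apply sumZ_le. intros k Hk.
  pose proof (sumZ_term n a k H Hk). specialize (H k). nra.
Qed.

Lemma l2_le (n : nat) (a b : Z -> R) :
  (forall k, (Z.abs k <= Z.of_nat n)%Z -> a k ^ 2 <= b k ^ 2) -> l2 n a <= l2 n b.
Proof. intros H. apply sqrt_le_1_alt, sumZ_le, H. Qed.

Lemma l2_le_of_sq (n : nat) (a : Z -> R) (A : R) :
  0 <= A -> sumZ n (fun k => a k ^ 2) <= A ^ 2 -> l2 n a <= A.
Proof.
  intros HA H. rewrite <- (sqrt_pow2 A HA). apply sqrt_le_1_alt, H.
Qed.

Lemma l2_triangle (n : nat) (a b : Z -> R) : l2 n (fun k => a k + b k) <= l2 n a + l2 n b.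
Proof.
  pose proof (l2_nonneg n a). pose proof (l2_nonneg n b).
  apply l2_le_of_sq; [lra|].
  pose proof (sumZ_cauchy_schwarz n a b).
  replace ((l2 n a + l2 n b) ^ 2) with (l2 n a ^ 2 + l2 n b ^ 2 + 2 * (l2 n a * l2 n b)) by ring.
  rewrite !l2_sq.
  rewrite (sumZ_ext n _ (fun k => (a k ^ 2 + b k ^ 2) + 2 * (a k * b k))) by (intros; ring).
  rewrite !sumZ_plus, sumZ_scal. lra.
Qed.

Lemma l2_scal (n : nat) (x : R) (a : Z -> R) : l2 n (fun k => x * a k) = Rabs x * l2 n a.
Proof.
  unfold l2. rewrite (sumZ_ext n _ (fun k => x ^ 2 * a k ^ 2)) by (intros; ring).
  rewrite sumZ_scal, sqrt_mult by (try apply pow2_ge_0; apply sumZ_sq_nonneg).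
  f_equal. rewrite <- sqrt_Rsqr_abs, Rsqr_pow2. reflexivity.
Qed.

(** * The quartic form *)

Definition cmod (z : C) : R := sqrt (Cnorm2 z).
(** Re(z conj w), so [ip] is the real part of the L^2 pairing, taken as a mean over the period,
    without the factor L. *)
Definition rdot (z w : C) : R := fst z * fst w + snd z * snd w.
Definition cub (a b c : C) : C := Cmul (Cmul a (Cconj b)) c.

Definition ip (n : nat) (x y : coef) : R := sumZ n (fun k => rdot (x k) (y k)).
(** The Wiener norm. It dominates the sup norm of P_n x and replaces it throughout, so no function
    of the space variable is ever evaluated. *)
Definition norm1 (n : nat) (x : coef) : R := sumZ n (fun k => cmod (x k)).
Definition norm2 (n : nat) (x : coef) : R := l2 n (fun k => cmod (x k)).

(** Orthogonality of the exponentials: the mean of e_k1 conj(e_k2) e_k3 conj(e_k4). *)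
Definition resonance (k1 k2 k3 k4 : Z) : R := if (k1 + k3 =? k2 + k4)%Z then 1 else 0.

Definition sum3 (n : nat) (F : Z -> Z -> Z -> R) : R :=
  sumZ n (fun k1 => sumZ n (fun k2 => sumZ n (fun k3 => F k1 k2 k3))).
Definition sum4 (n : nat) (F : Z -> Z -> Z -> Z -> R) : R :=
  sumZ n (fun k1 => sum3 n (F k1)).

(* [Q n u u u u] is the mean of |P_n u|^4. *)
Definition Q (n : nat) (a b c d : coef) : R :=
  sum4 n (fun k1 k2 k3 k4 => resonance k1 k2 k3 k4 * rdot (cub (a k1) (b k2) (c k3)) (d k4)).

(* Modes of P_n a conj(P_n b) P_n c. *)
Definition tri (n : nat) (a b c : coef) : coef := fun k =>
  (sum3 n (fun k1 k2 k3 => resonance k1 k2 k3 k * fst (cub (a k1) (b k2) (c k3))),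
   sum3 n (fun k1 k2 k3 => resonance k1 k2 k3 k * snd (cub (a k1) (b k2) (c k3)))).

Lemma Cnorm2_nonneg (z : C) : 0 <= Cnorm2 z.
Proof. unfold Cnorm2. nra. Qed.

Lemma cmod_nonneg (z : C) : 0 <= cmod z.
Proof. apply sqrt_pos. Qed.

Lemma cmod_sq (z : C) : cmod z ^ 2 = Cnorm2 z.
Proof. apply pow2_sqrt, Cnorm2_nonneg. Qed.

Lemma cmod_Cmul (z w : C) : cmod (Cmul z w) = cmod z * cmod w.
Proof.
  unfold cmod. rewrite <- sqrt_mult by apply Cnorm2_nonneg.
  f_equal. unfold Cnorm2, Cmul. simpl. ring.
Qed.

Lemma cmod_Cconj (z : C) : cmod (Cconj z) = cmod z.
Proof. unfold cmod. f_equal. unfold Cnorm2, Cconj. simpl. ring. Qed.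

Lemma cmod_cub (a b c : C) : cmod (cub a b c) = cmod a * cmod b * cmod c.
Proof. unfold cub. rewrite !cmod_Cmul, cmod_Cconj. reflexivity. Qed.

Lemma Rabs_le_of_sq (x y : R) : 0 <= y -> x ^ 2 <= y ^ 2 -> Rabs x <= y.
Proof.
  intros Hy H. rewrite <- (Rabs_pos_eq y Hy).
  apply Rsqr_le_abs_0. rewrite !Rsqr_pow2. exact H.
Qed.

Lemma rdot_le (z w : C) : Rabs (rdot z w) <= cmod z * cmod w.
Proof.
  pose proof (cmod_nonneg z). pose proof (cmod_nonneg w).
  apply Rabs_le_of_sq; [nra|].
  rewrite Rpow_mult_distr, !cmod_sq. unfold rdot, Cnorm2.
  pose proof (pow2_ge_0 (fst z * snd w - snd z * fst w)). nra.
Qed.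

Lemma cmod_Cadd (z w : C) : cmod (Cadd z w) <= cmod z + cmod w.
Proof.
  pose proof (cmod_nonneg z). pose proof (cmod_nonneg w).
  pose proof (rdot_le z w). pose proof (Rle_abs (rdot z w)).
  rewrite <- (Rabs_pos_eq (cmod (Cadd z w))) by apply cmod_nonneg.
  apply Rabs_le_of_sq; [lra|].
  replace ((cmod z + cmod w) ^ 2) with (cmod z ^ 2 + cmod w ^ 2 + 2 * (cmod z * cmod w)) by ring.
  rewrite !cmod_sq. unfold Cnorm2, Cadd, rdot in *. simpl in *. nra.
Qed.

Lemma cmod_Csub (z w : C) : cmod (Csub z w) <= cmod z + cmod w.
Proof.
  replace (cmod w) with (cmod (- fst w, - snd w)).
  - apply (cmod_Cadd z (- fst w, - snd w)).
  - unfold cmod. f_equal. unfold Cnorm2. simpl. ring.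
Qed.

Lemma norm1_nonneg (n : nat) (x : coef) : 0 <= norm1 n x.
Proof. apply sumZ_nonneg. intros. apply cmod_nonneg. Qed.

Lemma norm2_nonneg (n : nat) (x : coef) : 0 <= norm2 n x.
Proof. apply l2_nonneg. Qed.

Lemma norm2_sq (n : nat) (x : coef) : norm2 n x ^ 2 = sumZ n (fun k => Cnorm2 (x k)).
Proof. unfold norm2. rewrite l2_sq. apply sumZ_ext. intros. apply cmod_sq. Qed.

Lemma norm2_le_norm1 (n : nat) (x : coef) : norm2 n x <= norm1 n x.
Proof. apply l2_le_l1. intros. apply cmod_nonneg. Qed.

Lemma l2_sum_le (n : nat) (a b c : Z -> R) :
  (forall k, 0 <= a k) -> (forall k, a k <= b k + c k) -> l2 n a <= l2 n b + l2 n c.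
Proof.
  intros Ha H. eapply Rle_trans; [|apply l2_triangle].
  apply l2_le. intros k _. specialize (Ha k). specialize (H k). apply pow_incr. lra.
Qed.

Lemma norm2_Cadd (n : nat) (x y : coef) :
  norm2 n (fun k => Cadd (x k) (y k)) <= norm2 n x + norm2 n y.
Proof. apply l2_sum_le; intros; [apply cmod_nonneg|apply cmod_Cadd]. Qed.

Lemma norm2_Csub (n : nat) (x y : coef) :
  norm2 n (fun k => Csub (x k) (y k)) <= norm2 n x + norm2 n y.
Proof. apply l2_sum_le; intros; [apply cmod_nonneg|apply cmod_Csub]. Qed.

Lemma norm1_Csub (n : nat) (x y : coef) :
  norm1 n (fun k => Csub (x k) (y k)) <= norm1 n x + norm1 n y.
Proof. unfold norm1. rewrite <- sumZ_plus. apply sumZ_le. intros. apply cmod_Csub. Qed.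

Lemma ip_le (n : nat) (x y : coef) : Rabs (ip n x y) <= norm2 n x * norm2 n y.
Proof.
  eapply Rle_trans; [apply sumZ_abs|].
  eapply Rle_trans; [|apply sumZ_cauchy_schwarz].
  apply sumZ_le. intros. apply rdot_le.
Qed.

Lemma ip_self (n : nat) (x : coef) : ip n x x = norm2 n x ^ 2.
Proof. rewrite norm2_sq. apply sumZ_ext. intros. unfold rdot, Cnorm2. ring. Qed.

Lemma resonance_bounds (k1 k2 k3 k4 : Z) : 0 <= resonance k1 k2 k3 k4 <= 1.
Proof. unfold resonance. destruct Z.eqb; lra. Qed.

Lemma sumZ_le_1_of_single (n : nat) (g : Z -> R) (j : Z) :
  (forall k, g k = if (k =? j)%Z then 1 else 0) -> sumZ n g <= 1.
Proof.
  intros H. rewrite (sumZ_ext n g (fun k => if (k =? j)%Z then 1 else 0)) by auto.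
  rewrite sumZ_single. destruct Z.leb; lra.
Qed.

Lemma resonance_single (k1 k2 k3 k4 k j : Z) :
  (k1 + k3 = k2 + k4 <-> k = j)%Z -> resonance k1 k2 k3 k4 = if (k =? j)%Z then 1 else 0.
Proof.
  intros H. unfold resonance.
  destruct (Z.eqb_spec (k1 + k3) (k2 + k4)), (Z.eqb_spec k j); tauto || reflexivity.
Qed.

(** Three indices determine the fourth; these are the row and column bounds that [schur] asks
    for. *)
Lemma resonance_sum2 (n : nat) (k1 k3 k4 : Z) : sumZ n (fun k2 => resonance k1 k2 k3 k4) <= 1.
Proof. apply sumZ_le_1_of_single with (k1 + k3 - k4)%Z. intros. apply resonance_single. lia. Qed.
Lemma resonance_sum3 (n : nat) (k1 k2 k4 : Z) : sumZ n (fun k3 => resonance k1 k2 k3 k4) <= 1.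
Proof. apply sumZ_le_1_of_single with (k2 + k4 - k1)%Z. intros. apply resonance_single. lia. Qed.
Lemma resonance_sum4 (n : nat) (k1 k2 k3 : Z) : sumZ n (fun k4 => resonance k1 k2 k3 k4) <= 1.
Proof. apply sumZ_le_1_of_single with (k1 + k3 - k2)%Z. intros. apply resonance_single. lia. Qed.

Lemma resonance_swap13 (k1 k2 k3 k4 : Z) : resonance k3 k2 k1 k4 = resonance k1 k2 k3 k4.
Proof. unfold resonance. rewrite (Z.add_comm k3). reflexivity. Qed.
Lemma resonance_swap24 (k1 k2 k3 k4 : Z) : resonance k1 k4 k3 k2 = resonance k1 k2 k3 k4.
Proof. unfold resonance. rewrite (Z.add_comm k4). reflexivity. Qed.
Lemma resonance_conj (k1 k2 k3 k4 : Z) : resonance k2 k1 k4 k3 = resonance k1 k2 k3 k4.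
Proof. unfold resonance. rewrite Z.eqb_sym. reflexivity. Qed.

Lemma sum4_ext (n : nat) (F G : Z -> Z -> Z -> Z -> R) :
  (forall k1 k2 k3 k4, F k1 k2 k3 k4 = G k1 k2 k3 k4) -> sum4 n F = sum4 n G.
Proof. intros H. unfold sum4, sum3. repeat (apply sumZ_ext; intros). apply H. Qed.

Lemma sum4_le (n : nat) (F G : Z -> Z -> Z -> Z -> R) :
  (forall k1 k2 k3 k4, F k1 k2 k3 k4 <= G k1 k2 k3 k4) -> sum4 n F <= sum4 n G.
Proof. intros H. unfold sum4, sum3. repeat (apply sumZ_le; intros). apply H. Qed.

Lemma sum4_plus (n : nat) (F G : Z -> Z -> Z -> Z -> R) :
  sum4 n (fun k1 k2 k3 k4 => F k1 k2 k3 k4 + G k1 k2 k3 k4) = sum4 n F + sum4 n G.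
Proof.
  unfold sum4, sum3. rewrite <- sumZ_plus. apply sumZ_ext; intros.
  rewrite <- sumZ_plus. apply sumZ_ext; intros.
  rewrite <- sumZ_plus. apply sumZ_ext; intros.
  rewrite <- sumZ_plus. reflexivity.
Qed.

Lemma sum4_scal (n : nat) (x : R) (F : Z -> Z -> Z -> Z -> R) :
  sum4 n (fun k1 k2 k3 k4 => x * F k1 k2 k3 k4) = x * sum4 n F.
Proof.
  unfold sum4, sum3. rewrite <- sumZ_scal. apply sumZ_ext; intros.
  rewrite <- sumZ_scal. apply sumZ_ext; intros.
  rewrite <- sumZ_scal. apply sumZ_ext; intros.
  rewrite <- sumZ_scal. reflexivity.
Qed.

Lemma sum4_abs (n : nat) (F : Z -> Z -> Z -> Z -> R) :
  Rabs (sum4 n F) <= sum4 n (fun k1 k2 k3 k4 => Rabs (F k1 k2 k3 k4)).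
Proof.
  unfold sum4, sum3.
  do 3 (eapply Rle_trans; [apply sumZ_abs|]; apply sumZ_le; intros).
  apply sumZ_abs.
Qed.

Lemma sum4_swap12 (n : nat) (F : Z -> Z -> Z -> Z -> R) :
  sum4 n F = sum4 n (fun k2 k1 k3 k4 => F k1 k2 k3 k4).
Proof. unfold sum4, sum3. rewrite sumZ_exchange. reflexivity. Qed.
Lemma sum4_swap23 (n : nat) (F : Z -> Z -> Z -> Z -> R) :
  sum4 n F = sum4 n (fun k1 k3 k2 k4 => F k1 k2 k3 k4).
Proof. unfold sum4, sum3. apply sumZ_ext; intros. rewrite sumZ_exchange. reflexivity. Qed.
Lemma sum4_swap34 (n : nat) (F : Z -> Z -> Z -> Z -> R) :
  sum4 n F = sum4 n (fun k1 k2 k4 k3 => F k1 k2 k3 k4).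
Proof. unfold sum4, sum3. do 2 (apply sumZ_ext; intros). rewrite sumZ_exchange. reflexivity. Qed.
Lemma sum4_swap13 (n : nat) (F : Z -> Z -> Z -> Z -> R) :
  sum4 n F = sum4 n (fun k3 k2 k1 k4 => F k1 k2 k3 k4).
Proof. rewrite sum4_swap12, sum4_swap23, sum4_swap12. reflexivity. Qed.
Lemma sum4_swap24 (n : nat) (F : Z -> Z -> Z -> Z -> R) :
  sum4 n F = sum4 n (fun k1 k4 k3 k2 => F k1 k2 k3 k4).
Proof. rewrite sum4_swap23, sum4_swap34, sum4_swap23. reflexivity. Qed.

(** The three symmetries together carry any argument to the last place. Additivity is therefore
    checked only there, and the four terms in the derivative of Q n u u u u coincide. *)
Lemma Q_swap13 (n : nat) (a b c d : coef) : Q n a b c d = Q n c b a d.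
Proof.
  unfold Q. rewrite sum4_swap13. apply sum4_ext. intros.
  rewrite resonance_swap13. unfold rdot, cub, Cmul, Cconj. simpl. ring.
Qed.
Lemma Q_swap24 (n : nat) (a b c d : coef) : Q n a b c d = Q n a d c b.
Proof.
  unfold Q. rewrite sum4_swap24. apply sum4_ext. intros.
  rewrite resonance_swap24. unfold rdot, cub, Cmul, Cconj. simpl. ring.
Qed.
Lemma Q_conj (n : nat) (a b c d : coef) : Q n a b c d = Q n b a d c.
Proof.
  unfold Q. rewrite sum4_swap12, sum4_swap34. apply sum4_ext. intros.
  rewrite resonance_conj. unfold rdot, cub, Cmul, Cconj. simpl. ring.
Qed.

Definition sub (x y : coef) : coef := fun k => Csub (x k) (y k).

Lemma sum4_minus (n : nat) (F G : Z -> Z -> Z -> Z -> R) :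
  sum4 n F - sum4 n G = sum4 n (fun k1 k2 k3 k4 => F k1 k2 k3 k4 + -1 * G k1 k2 k3 k4).
Proof. rewrite sum4_plus, sum4_scal. ring. Qed.

Lemma Q_sub4 (n : nat) (a b c d d' : coef) : Q n a b c (sub d d') = Q n a b c d - Q n a b c d'.
Proof.
  unfold Q. rewrite sum4_minus. apply sum4_ext. intros.
  unfold sub, rdot, Csub. simpl. ring.
Qed.
Lemma Q_sub3 (n : nat) (a b c c' d : coef) : Q n a b (sub c c') d = Q n a b c d - Q n a b c' d.
Proof. rewrite !(Q_conj n a b). apply Q_sub4. Qed.
Lemma Q_sub2 (n : nat) (a b b' c d : coef) : Q n a (sub b b') c d = Q n a b c d - Q n a b' c d.
Proof. rewrite !(Q_swap24 n a _ c d). apply Q_sub4. Qed.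
Lemma Q_sub1 (n : nat) (a a' b c d : coef) : Q n (sub a a') b c d = Q n a b c d - Q n a' b c d.
Proof. rewrite !(Q_swap13 n _ b c d). apply Q_sub3. Qed.

(** With the symmetries of [Q] this identifies [tri n u u u] as the gradient of Q/4. *)
Lemma ip_tri (n : nat) (a b c d : coef) : ip n (tri n a b c) d = Q n a b c d.
Proof.
  unfold Q, ip.
  rewrite sum4_swap34, sum4_swap23, sum4_swap12.
  unfold sum4. apply sumZ_ext. intros k _.
  unfold rdot, tri, sum3. simpl fst. simpl snd.
  rewrite !(Rmult_comm (sumZ _ _)), <- !sumZ_scal, <- sumZ_plus. apply sumZ_ext. intros.
  rewrite <- !sumZ_scal, <- sumZ_plus. apply sumZ_ext. intros.
  rewrite <- !sumZ_scal, <- sumZ_plus. apply sumZ_ext. intros. ring.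
Qed.

(** * Multilinear estimates for the quartic form *)

Definition absQ (n : nat) (a b c d : Z -> R) : R :=
  sum4 n (fun k1 k2 k3 k4 => resonance k1 k2 k3 k4 * (a k1 * b k2 * (c k3 * d k4))).

(** Discrete Hölder inequality with two sup norms and two L^2 norms: for fixed k1, k2 the remaining
    double sum is a Schur form with the resonance kernel. *)
Lemma absQ_le34 (n : nat) (a b c d : Z -> R) :
  (forall k, 0 <= a k) -> (forall k, 0 <= b k) ->
  absQ n a b c d <= sumZ n a * sumZ n b * l2 n c * l2 n d.
Proof.
  intros Ha Hb. unfold absQ, sum4, sum3.
  replace (sumZ n a * sumZ n b * l2 n c * l2 n d)
    with ((sumZ n b * l2 n c * l2 n d) * sumZ n a) by ring.
  rewrite <- sumZ_scal. apply sumZ_le. intros k1 _.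
  replace (sumZ n b * l2 n c * l2 n d * a k1)
    with ((a k1 * l2 n c * l2 n d) * sumZ n b) by ring.
  rewrite <- sumZ_scal. apply sumZ_le. intros k2 _.
  assert (H : sumZ n (fun k3 => sumZ n (fun k4 => resonance k1 k2 k3 k4 * (c k3 * d k4)))
              <= l2 n c * l2 n d).
  { apply schur; intros.
    - apply resonance_bounds.
    - apply resonance_sum4.
    - apply resonance_sum3. }
  apply Rmult_le_compat_l with (r := a k1 * b k2) in H; [|apply Rmult_le_pos; auto].
  rewrite <- sumZ_scal in H.
  replace (a k1 * l2 n c * l2 n d * b k2) with (a k1 * b k2 * (l2 n c * l2 n d)) by ring.
  eapply Rle_trans; [|exact H]. right. apply sumZ_ext. intros. rewrite <- sumZ_scal.
  apply sumZ_ext. intros. ring.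
Qed.

Lemma absQ_swap13 (n : nat) (a b c d : Z -> R) : absQ n a b c d = absQ n c b a d.
Proof.
  unfold absQ. rewrite sum4_swap13. apply sum4_ext. intros. rewrite resonance_swap13. ring.
Qed.

(** The conjugated slots 2 and 4 need a Schur form of their own, with k1, k3 fixed. This case arises
    when a derivative falls on the second argument. *)
Lemma absQ_le24 (n : nat) (a b c d : Z -> R) :
  (forall k, 0 <= a k) -> (forall k, 0 <= c k) ->
  absQ n a b c d <= sumZ n a * l2 n b * sumZ n c * l2 n d.
Proof.
  intros Ha Hb. unfold absQ. rewrite sum4_swap23. unfold sum4, sum3.
  replace (sumZ n a * l2 n b * sumZ n c * l2 n d)
    with ((sumZ n c * l2 n b * l2 n d) * sumZ n a) by ring.
  rewrite <- sumZ_scal. apply sumZ_le. intros k1 _.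
  replace (sumZ n c * l2 n b * l2 n d * a k1)
    with ((a k1 * l2 n b * l2 n d) * sumZ n c) by ring.
  rewrite <- sumZ_scal. apply sumZ_le. intros k3 _.
  assert (H : sumZ n (fun k2 => sumZ n (fun k4 => resonance k1 k2 k3 k4 * (b k2 * d k4)))
              <= l2 n b * l2 n d).
  { apply schur; intros.
    - apply resonance_bounds.
    - apply resonance_sum4.
    - apply resonance_sum2. }
  apply Rmult_le_compat_l with (r := a k1 * c k3) in H; [|apply Rmult_le_pos; auto].
  rewrite <- sumZ_scal in H.
  replace (a k1 * l2 n b * l2 n d * c k3) with (a k1 * c k3 * (l2 n b * l2 n d)) by ring.
  eapply Rle_trans; [|exact H]. right. apply sumZ_ext. intros. rewrite <- sumZ_scal.
  apply sumZ_ext. intros. ring.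
Qed.

Lemma rdot_cub_le (a b c d : C) :
  Rabs (rdot (cub a b c) d) <= cmod a * cmod b * (cmod c * cmod d).
Proof. eapply Rle_trans; [apply rdot_le|]. rewrite cmod_cub. right. ring. Qed.

Lemma Q_le (n : nat) (a b c d : coef) :
  Rabs (Q n a b c d) <= norm1 n a * norm1 n b * norm2 n c * norm2 n d.
Proof.
  eapply Rle_trans; [apply sum4_abs|].
  eapply Rle_trans; [|apply absQ_le34; intros; apply cmod_nonneg].
  apply sum4_le. intros. rewrite Rabs_mult, Rabs_pos_eq by apply resonance_bounds.
  apply Rmult_le_compat_l; [apply resonance_bounds|]. apply rdot_cub_le.
Qed.

Definition cscal (x : R) (z : C) : C := (x * fst z, x * snd z).
(** The symbol of -i d/dx. Being real it commutes with [rot], and applied twice it gives minus the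
    second derivative. *)
Definition dx (L : R) (x : coef) : coef := fun k => cscal (freq L k) (x k).

Lemma cmod_cscal (x : R) (z : C) : cmod (cscal x z) = Rabs x * cmod z.
Proof.
  unfold cmod, cscal, Cnorm2. simpl fst. simpl snd.
  replace ((x * fst z) ^ 2 + (x * snd z) ^ 2) with (Rsqr x * (fst z ^ 2 + snd z ^ 2))
    by (unfold Rsqr; ring).
  rewrite sqrt_mult, sqrt_Rsqr_abs; [reflexivity|apply Rle_0_sqr|nra].
Qed.

Lemma freq_add (L : R) (j k : Z) : freq L (j + k) = freq L j + freq L k.
Proof. unfold freq. rewrite plus_IZR. unfold Rdiv. ring. Qed.

Lemma freq_opp (L : R) (k : Z) : freq L (- k) = - freq L k.
Proof. unfold freq. rewrite opp_IZR. unfold Rdiv. ring. Qed.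

(* On the resonant set k4 = k1 - k2 + k3, so one of the two derivatives on the last argument
   can be moved onto one of the other three. *)
Lemma Q_dxx_le (L : R) (n : nat) (a b c d : coef) :
  Rabs (Q n a b c (dx L (dx L d)))
  <= norm2 n (dx L a) * norm1 n b * norm1 n c * norm2 n (dx L d)
     + norm1 n a * norm2 n (dx L b) * norm1 n c * norm2 n (dx L d)
     + norm1 n a * norm1 n b * norm2 n (dx L c) * norm2 n (dx L d).
Proof.
  eapply Rle_trans; [apply sum4_abs|].
  assert (P : forall (x : coef) k, 0 <= cmod (x k)) by (intros; apply cmod_nonneg).
  apply Rle_trans with
    (absQ n (fun k => cmod (dx L a k)) (fun k => cmod (b k)) (fun k => cmod (c k)) (fun k => cmod (dx L d k))
     + absQ n (fun k => cmod (a k)) (fun k => cmod (dx L b k)) (fun k => cmod (c k)) (fun k => cmod (dx L d k))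
     + absQ n (fun k => cmod (a k)) (fun k => cmod (b k)) (fun k => cmod (dx L c k)) (fun k => cmod (dx L d k))).
  - unfold absQ. rewrite <- !sum4_plus. apply sum4_le. intros.
    unfold resonance. destruct (Z.eqb_spec (k1 + k3) (k2 + k4)) as [e|e].
    2:{ rewrite Rmult_0_l, Rabs_R0. lra. }
    rewrite Rmult_1_l.
    eapply Rle_trans; [apply rdot_cub_le|].
    unfold dx. rewrite !cmod_cscal.
    assert (F : Rabs (freq L k4) <= Rabs (freq L k1) + Rabs (freq L k2) + Rabs (freq L k3)).
    { replace k4 with (k1 + - k2 + k3)%Z by lia. rewrite !freq_add, freq_opp.
      eapply Rle_trans; [apply Rabs_triang|]. apply Rplus_le_compat_r.
      eapply Rle_trans; [apply Rabs_triang|]. rewrite Rabs_Ropp. lra. }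
    assert (G : 0 <= cmod (a k1) * cmod (b k2) * cmod (c k3) * (Rabs (freq L k4) * cmod (d k4))).
    { repeat apply Rmult_le_pos; try apply Rabs_pos; apply cmod_nonneg. }
    apply (Rmult_le_compat_l _ _ _ G) in F.
    eapply Rle_trans; [|eapply Rle_trans; [exact F|]]; right; ring.
  - repeat apply Rplus_le_compat.
    + rewrite absQ_swap13. eapply Rle_trans; [apply absQ_le34; intros; apply cmod_nonneg|].
      right. unfold norm1, norm2. ring.
    + apply absQ_le24; intros; apply cmod_nonneg.
    + apply absQ_le34; intros; apply cmod_nonneg.
Qed.

(** Duality: [Q_le] is tested with d = [tri n a b c] and one factor of the norm is divided out. *)
Lemma norm2_tri_le (n : nat) (a b c : coef) :
  norm2 n (tri n a b c) <= norm1 n a * norm1 n b * norm2 n c.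
Proof.
  pose proof (Q_le n a b c (tri n a b c)) as H.
  rewrite <- ip_tri, ip_self in H.
  pose proof (norm2_nonneg n (tri n a b c)) as [h|h].
  - rewrite Rabs_pos_eq in H by nra. apply Rmult_le_reg_r with (norm2 n (tri n a b c)); [exact h|].
    simpl in H. lra.
  - rewrite <- h. repeat apply Rmult_le_pos; try apply norm1_nonneg. apply norm2_nonneg.
Qed.

(** Gauge invariance, the reason why the cubic term conserves mass. Moving i from the conjugated
    slot 4 to slot 3 changes the sign, while [Q_conj] says that both placements agree. *)
Lemma Q_i_self (n : nat) (u : coef) : Q n u u u (fun k => Cmul Ci (u k)) = 0.
Proof.
  assert (H : Q n u u u (fun k => Cmul Ci (u k)) = - Q n u u (fun k => Cmul Ci (u k)) u).
  { unfold Q. transitivity (0 - sum4 n (fun k1 k2 k3 k4 => resonance k1 k2 k3 k4 *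
       rdot (cub (u k1) (u k2) (Cmul Ci (u k3))) (u k4))); [|ring].
    replace 0 with (sum4 n (fun _ _ _ _ => 0)) at 1.
    - rewrite sum4_minus. apply sum4_ext. intros. unfold rdot, cub, Cmul, Cconj, Ci. simpl. ring.
    - unfold sum4, sum3. rewrite !sumZ_zero. reflexivity. }
  rewrite (Q_conj n u u (fun k => Cmul Ci (u k))) in H. lra.
Qed.

(** * Time derivatives *)

Definition cderiv (z : R -> C) (t : R) (d : C) : Prop :=
  derivable_pt_lim (fun s => fst (z s)) t (fst d) /\
  derivable_pt_lim (fun s => snd (z s)) t (snd d).

Lemma derivable_pt_lim_eq (f : R -> R) (t l l' : R) :
  derivable_pt_lim f t l -> l = l' -> derivable_pt_lim f t l'.
Proof. intros H <-. exact H. Qed.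

Lemma cderiv_Cmul (z w : R -> C) (t : R) (dz dw : C) :
  cderiv z t dz -> cderiv w t dw ->
  cderiv (fun s => Cmul (z s) (w s)) t (Cadd (Cmul dz (w t)) (Cmul (z t) dw)).
Proof.
  intros [Hz1 Hz2] [Hw1 Hw2]. split; unfold Cmul, Cadd; simpl.
  - eapply derivable_pt_lim_eq.
    + apply (derivable_pt_lim_minus (fun s => fst (z s) * fst (w s)) (fun s => snd (z s) * snd (w s)));
      apply (derivable_pt_lim_mult (fun s => _ (z s)) (fun s => _ (w s))); eassumption.
    + simpl. ring.
  - eapply derivable_pt_lim_eq.
    + apply (derivable_pt_lim_plus (fun s => fst (z s) * snd (w s)) (fun s => snd (z s) * fst (w s)));
      apply (derivable_pt_lim_mult (fun s => _ (z s)) (fun s => _ (w s))); eassumption.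
    + simpl. ring.
Qed.

Lemma cderiv_Cconj (z : R -> C) (t : R) (dz : C) :
  cderiv z t dz -> cderiv (fun s => Cconj (z s)) t (Cconj dz).
Proof.
  intros [H1 H2]. split; [exact H1|]. apply (derivable_pt_lim_opp (fun s => snd (z s))). exact H2.
Qed.

Lemma cderiv_Csub (z w : R -> C) (t : R) (dz dw : C) :
  cderiv z t dz -> cderiv w t dw -> cderiv (fun s => Csub (z s) (w s)) t (Csub dz dw).
Proof.
  intros [Hz1 Hz2] [Hw1 Hw2]. split.
  - apply (derivable_pt_lim_minus (fun s => fst (z s)) (fun s => fst (w s))); assumption.
  - apply (derivable_pt_lim_minus (fun s => snd (z s)) (fun s => snd (w s))); assumption.
Qed.

Lemma cderiv_const (z : C) (t : R) : cderiv (fun _ => z) t (0, 0).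
Proof. split; apply derivable_pt_lim_const. Qed.

Lemma cderiv_cscal (x : R) (z : R -> C) (t : R) (d : C) :
  cderiv z t d -> cderiv (fun s => cscal x (z s)) t (cscal x d).
Proof.
  intros [H1 H2]. split.
  - apply (derivable_pt_lim_scal (fun s => fst (z s))). exact H1.
  - apply (derivable_pt_lim_scal (fun s => snd (z s))). exact H2.
Qed.

Lemma rdot_derivable (z w : R -> C) (t : R) (dz dw : C) :
  cderiv z t dz -> cderiv w t dw ->
  derivable_pt_lim (fun s => rdot (z s) (w s)) t (rdot dz (w t) + rdot (z t) dw).
Proof.
  intros [Hz1 Hz2] [Hw1 Hw2]. unfold rdot.
  eapply derivable_pt_lim_eq.
  - apply (derivable_pt_lim_plus (fun s => fst (z s) * fst (w s)) (fun s => snd (z s) * snd (w s)));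
    apply (derivable_pt_lim_mult (fun s => _ (z s)) (fun s => _ (w s))); eassumption.
  - simpl. ring.
Qed.

Definition path_deriv (n : nat) (x : R -> coef) (t : R) (d : coef) : Prop :=
  forall k, (Z.abs k <= Z.of_nat n)%Z -> cderiv (fun s => x s k) t (d k).

Lemma ip_derivable (n : nat) (x y : R -> coef) (t : R) (dx dy : coef) :
  path_deriv n x t dx -> path_deriv n y t dy ->
  derivable_pt_lim (fun s => ip n (x s) (y s)) t (ip n dx (y t) + ip n (x t) dy).
Proof.
  intros Hx Hy. unfold ip. rewrite <- sumZ_plus.
  apply (sumZ_derivable n (fun s k => rdot (x s k) (y s k))). intros k Hk.
  apply (rdot_derivable (fun s => x s k) (fun s => y s k)); auto.
Qed.

Lemma Q_derivable (n : nat) (a b c d : R -> coef) (t : R) (da db dc dd : coef) :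
  path_deriv n a t da -> path_deriv n b t db -> path_deriv n c t dc -> path_deriv n d t dd ->
  derivable_pt_lim (fun s => Q n (a s) (b s) (c s) (d s)) t
    (Q n da (b t) (c t) (d t) + Q n (a t) db (c t) (d t)
     + Q n (a t) (b t) dc (d t) + Q n (a t) (b t) (c t) dd).
Proof.
  intros Ha Hb Hc Hd. unfold Q. rewrite <- !sum4_plus. unfold sum4, sum3.
  apply (sumZ_derivable n (fun s k1 => _)). intros k1 H1.
  apply (sumZ_derivable n (fun s k2 => _)). intros k2 H2.
  apply (sumZ_derivable n (fun s k3 => _)). intros k3 H3.
  apply (sumZ_derivable n (fun s k4 => _)). intros k4 H4.
  specialize (Ha k1 H1). specialize (Hb k2 H2). specialize (Hc k3 H3). specialize (Hd k4 H4).
  eapply derivable_pt_lim_eq.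
  - apply (derivable_pt_lim_scal
             (fun s => rdot (cub (a s k1) (b s k2) (c s k3)) (d s k4)) (resonance k1 k2 k3 k4)).
    apply (rdot_derivable (fun s => cub (a s k1) (b s k2) (c s k3)) (fun s => d s k4)); [|exact Hd].
    apply (cderiv_Cmul (fun s => Cmul (a s k1) (Cconj (b s k2)))); [|exact Hc].
    apply (cderiv_Cmul (fun s => a s k1)); [exact Ha|].
    apply (cderiv_Cconj (fun s => b s k2)). exact Hb.
  - simpl. unfold rdot, cub, Cmul, Cconj, Cadd. simpl. ring.
Qed.

(** * Tails and interpolation *)

Lemma freq_mult (L : R) (k : Z) : freq L k = 2 * PI / L * IZR k.
Proof. unfold freq, Rdiv. ring. Qed.

Lemma lam_pos (L : R) : 0 < L -> 0 < 2 * PI / L.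
Proof. intros H. apply Rdiv_lt_0_compat; [|exact H]. pose proof PI_RGT_0. lra. Qed.

Lemma sum_inv_sq_tail (m n : nat) : (1 <= m)%nat ->
  sumZ n (fun k => (if (Z.abs k <=? Z.of_nat m)%Z then 0 else / IZR k) ^ 2) <= 2 / INR m.
Proof.
  intros Hm. set (g := fun k => _).
  assert (Hm' : 1 <= INR m) by (apply (le_INR 1); exact Hm).
  destruct (le_lt_dec n m) as [h|h].
  - rewrite (sumZ_ext n g (fun _ => 0)).
    + rewrite sumZ_zero. apply Rlt_le, Rdiv_lt_0_compat; lra.
    + intros k Hk. unfold g. destruct (Z.leb_spec (Z.abs k) (Z.of_nat m)); [ring|lia].
  (* Strengthened to a telescoping bound so that the induction closes: 2/(n+1)^2 <= 2/n -
     2/(n+1). *)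
  - assert (H : sumZ n g <= 2 / INR m - 2 / INR n).
    { assert (E : sumZ m g = 0).
      { rewrite (sumZ_ext m g (fun _ => 0)); [apply sumZ_zero|].
        intros k Hk. unfold g. destruct (Z.leb_spec (Z.abs k) (Z.of_nat m)); [ring|lia]. }
      apply Nat.lt_le_incl in h. induction h as [|n h IH]; [lra|].
      rewrite sumZ_S. unfold g at 2 3.
      destruct (Z.leb_spec (Z.abs (Z.of_nat (S n))) (Z.of_nat m)) as [h1|h1]; [lia|].
      destruct (Z.leb_spec (Z.abs (- Z.of_nat (S n))) (Z.of_nat m)) as [h2|h2]; [lia|].
      rewrite opp_IZR, <- INR_IZR_INZ, S_INR.
      assert (Hn : 1 <= INR n) by (apply Rle_trans with (INR m); [lra|apply le_INR; exact h]).
      assert (2 * (/ (INR n + 1)) ^ 2 <= 2 / INR n - 2 / (INR n + 1)); [|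
        replace ((/ - (INR n + 1)) ^ 2) with ((/ (INR n + 1)) ^ 2) by (field; lra); lra].
      replace (2 / INR n - 2 / (INR n + 1)) with (2 * (/ (INR n + 1)) ^ 2 * ((INR n + 1) / INR n))
        by (field; lra).
      assert (1 <= (INR n + 1) / INR n).
      { apply Rmult_le_reg_r with (INR n); [lra|]. unfold Rdiv. rewrite Rmult_assoc, Rinv_l; lra. }
      pose proof (pow2_ge_0 (/ (INR n + 1))). nra. }
    assert (0 < 2 / INR n); [|lra].
    apply Rdiv_lt_0_compat; [lra|]. apply lt_0_INR. lia.
Qed.

(** Cauchy-Schwarz with weights 1/k and k. The tail of the series of 1/k^2 yields the factor
    m^(-1/2) on which the whole argument rests. *)
Lemma sumZ_tail_le (L : R) (m n : nat) (x : Z -> R) :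
  0 < L -> (1 <= m)%nat -> (forall k, (Z.abs k <= Z.of_nat m)%Z -> x k = 0) ->
  sumZ n x <= sqrt (2 / INR m) / (2 * PI / L) * l2 n (fun k => freq L k * x k).
Proof.
  intros HL Hm Hx. pose proof (lam_pos L HL) as Hl.
  rewrite (sumZ_ext n x (fun k => (if (Z.abs k <=? Z.of_nat m)%Z then 0 else / IZR k) * (IZR k * x k))).
  2:{ intros k _. destruct (Z.leb_spec (Z.abs k) (Z.of_nat m)).
      - rewrite Hx by assumption. ring.
      - field. apply not_0_IZR. lia. }
  eapply Rle_trans; [apply sumZ_cauchy_schwarz|].
  replace (l2 n (fun k => freq L k * x k)) with ((2 * PI / L) * l2 n (fun k => IZR k * x k)).
  2:{ rewrite <- (Rabs_pos_eq (2 * PI / L)) at 1 by lra. rewrite <- l2_scal.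
      unfold l2. f_equal. apply sumZ_ext. intros. rewrite freq_mult. ring. }
  replace (sqrt (2 / INR m) / (2 * PI / L) * (2 * PI / L * l2 n (fun k => IZR k * x k)))
    with (sqrt (2 / INR m) * l2 n (fun k => IZR k * x k)).
  2:{ unfold Rdiv at 2. rewrite Rmult_assoc, <- (Rmult_assoc (/ _)), Rinv_l by lra. ring. }
  apply Rmult_le_compat_r; [apply l2_nonneg|].
  apply sqrt_le_1_alt, sum_inv_sq_tail, Hm.
Qed.

Lemma norm2_dx (L : R) (n : nat) (c : coef) :
  norm2 n (dx L c) = l2 n (fun k => freq L k * cmod (c k)).
Proof.
  unfold norm2, l2. f_equal. apply sumZ_ext. intros k _. unfold dx.
  rewrite cmod_cscal, !Rpow_mult_distr, pow2_abs. reflexivity.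
Qed.

Lemma cmod_zero : cmod (0, 0) = 0.
Proof. unfold cmod. replace (Cnorm2 (0, 0)) with 0 by (unfold Cnorm2; simpl; ring). apply sqrt_0. Qed.

Lemma norm1_tail_le (L : R) (m n : nat) (w : coef) :
  0 < L -> (1 <= m)%nat -> (forall k, (Z.abs k <= Z.of_nat m)%Z -> w k = (0, 0)) ->
  norm1 n w <= sqrt (2 / INR m) / (2 * PI / L) * norm2 n (dx L w).
Proof.
  intros HL Hm Hw. rewrite norm2_dx. apply sumZ_tail_le; auto.
  intros k Hk. rewrite Hw by exact Hk. apply cmod_zero.
Qed.

Definition lowp (N : nat) (c : coef) : coef :=
  fun k => if (Z.abs k <=? Z.of_nat N)%Z then c k else (0, 0).

Lemma cmod_lowp_le (N : nat) (c : coef) (k : Z) : cmod (lowp N c k) <= cmod (c k).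
Proof.
  unfold lowp. destruct Z.leb; [lra|]. rewrite cmod_zero. apply cmod_nonneg.
Qed.

Lemma cmod_highp_le (N : nat) (c : coef) (k : Z) : cmod (sub c (lowp N c) k) <= cmod (c k).
Proof.
  unfold sub, lowp. destruct Z.leb.
  - replace (Csub (c k) (c k)) with (0, 0) by (unfold Csub; f_equal; ring).
    rewrite cmod_zero. apply cmod_nonneg.
  - right. f_equal. unfold Csub. simpl. rewrite !Rminus_0_r. destruct (c k); reflexivity.
Qed.

Lemma highp_low (N : nat) (c : coef) (k : Z) :
  (Z.abs k <= Z.of_nat N)%Z -> sub c (lowp N c) k = (0, 0).
Proof.
  intros H. unfold sub, lowp. destruct (Z.leb_spec (Z.abs k) (Z.of_nat N)); [|lia].
  unfold Csub. f_equal; ring.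
Qed.

Lemma cmod_split (N : nat) (c : coef) (k : Z) :
  cmod (c k) <= cmod (lowp N c k) + cmod (sub c (lowp N c) k).
Proof.
  replace (c k) with (Cadd (lowp N c k) (sub c (lowp N c) k)) at 1; [apply cmod_Cadd|].
  unfold sub, Cadd, Csub. destruct (c k), (lowp N c k); simpl; f_equal; ring.
Qed.

Lemma norm1_low_le (N n : nat) (c : coef) :
  norm1 n (lowp N c) <= sqrt (2 * INR N + 1) * norm2 n c.
Proof.
  unfold norm1, norm2.
  rewrite (sumZ_ext n _ (fun k => (if (Z.abs k <=? Z.of_nat N)%Z then 1 else 0) * cmod (c k))).
  2:{ intros k _. unfold lowp. destruct Z.leb; [ring|]. rewrite cmod_zero. ring. }
  eapply Rle_trans; [apply sumZ_cauchy_schwarz|].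
  apply Rmult_le_compat_r; [apply l2_nonneg|]. apply sqrt_le_1_alt.
  set (g := fun k => _ ^ 2).
  (* No order between n and N is assumed; the maximum covers both cases. *)
  apply Rle_trans with (sumZ (Nat.max n N) g).
  { apply sumZ_mono; [|lia]. intros. apply pow2_ge_0. }
  rewrite (sumZ_support N (Nat.max n N) g).
  - rewrite (sumZ_ext N g (fun _ => 1)); [rewrite sumZ_const; lra|].
    intros k Hk. unfold g. destruct (Z.leb_spec (Z.abs k) (Z.of_nat N)); [ring|lia].
  - lia.
  - intros k Hk. unfold g. destruct (Z.leb_spec (Z.abs k) (Z.of_nat N)); [lia|ring].
Qed.

(** Agmon-type interpolation by splitting at frequency N: the 2N + 1 low modes are paid for with
    |c|, the high modes carry a factor of order 1/N in front of |c_x|^2. C0 does not depend on n. *)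
Lemma norm1_interp (L eps : R) : 0 < L -> 0 < eps ->
  exists C0, 0 <= C0 /\ forall n c,
    norm1 n c ^ 2 <= C0 * norm2 n c ^ 2 + eps * norm2 n (dx L c) ^ 2.
Proof.
  intros HL He. pose proof (lam_pos L HL) as Hl. set (lam := 2 * PI / L) in *.
  assert (Hp : 0 < eps * lam ^ 2) by (apply Rmult_lt_0_compat; nra).
  (* The 4 is the 2 of the tail bound times the 2 from (a + b)^2 <= 2 a^2 + 2 b^2. *)
  destruct (INR_archimed (eps * lam ^ 2) 4 Hp) as [N HN].
  assert (HN1 : (1 <= N)%nat).
  { destruct N; [simpl in HN; lra|lia]. }
  assert (HN2 : 1 <= INR N) by (apply (le_INR 1); exact HN1).
  exists (2 * (2 * INR N + 1)). split; [lra|]. intros n c.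
  pose proof (norm1_low_le N n c) as H1.
  assert (H2 : norm1 n (sub c (lowp N c)) <= sqrt (2 / INR N) / lam * norm2 n (dx L c)).
  { eapply Rle_trans; [apply (norm1_tail_le L N); auto; intros; apply highp_low; assumption|].
    apply Rmult_le_compat_l.
    - apply Rmult_le_pos; [apply sqrt_pos|]. apply Rlt_le, Rinv_0_lt_compat. exact Hl.
    - rewrite !norm2_dx. apply l2_le. intros k _.
      rewrite !Rpow_mult_distr. apply Rmult_le_compat_l; [apply pow2_ge_0|].
      apply pow_incr. split; [apply cmod_nonneg|apply cmod_highp_le]. }
  assert (H3 : norm1 n c <= norm1 n (lowp N c) + norm1 n (sub c (lowp N c))).
  { unfold norm1. rewrite <- sumZ_plus. apply sumZ_le. intros. apply cmod_split. }
  set (a := sqrt (2 * INR N + 1) * norm2 n c) in *.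
  set (b := sqrt (2 / INR N) / lam * norm2 n (dx L c)) in *.
  pose proof (norm1_nonneg n c).
  apply Rle_trans with ((a + b) ^ 2); [apply pow_incr; lra|].
  apply Rle_trans with (2 * a ^ 2 + 2 * b ^ 2); [pose proof (pow2_ge_0 (a - b)); nra|].
  assert (Ea : a ^ 2 = (2 * INR N + 1) * norm2 n c ^ 2).
  { unfold a. rewrite Rpow_mult_distr, pow2_sqrt by lra. reflexivity. }
  assert (Eb : b ^ 2 = 2 / (INR N * lam ^ 2) * norm2 n (dx L c) ^ 2).
  { unfold b, Rdiv. rewrite !Rpow_mult_distr, pow2_sqrt.
    - field. lra.
    - apply Rmult_le_pos; [lra|]. apply Rlt_le, Rinv_0_lt_compat. lra. }
  rewrite Ea, Eb.
  assert (2 * (2 / (INR N * lam ^ 2)) <= eps).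
  { apply Rmult_le_reg_r with (INR N * lam ^ 2); [apply Rmult_lt_0_compat; nra|].
    replace (2 * (2 / (INR N * lam ^ 2)) * (INR N * lam ^ 2)) with 4 by (field; lra). nra. }
  pose proof (pow2_ge_0 (norm2 n (dx L c))). nra.
Qed.

(** * Differential inequalities on the whole line *)

Lemma nonincreasing_of_deriv_nonpos (F G : R -> R) :
  (forall t, derivable_pt_lim F t (G t)) -> (forall t, G t <= 0) ->
  forall s t, s <= t -> F t <= F s.
Proof.
  intros HF HG s t [Hst|<-]; [|lra].
  destruct (MVT_cor2 F G s t Hst) as [c [Hc _]]; [auto|].
  specialize (HG c). nra.
Qed.

(** The product of exp(a t) and F - b/a is nonincreasing, so a value above b/a would force unbounded
    growth as t goes to minus infinity. M does not enter the conclusion: bounds that depend on the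
    attractor are traded for bounds that do not. *)
Lemma gronwall_line (F : R -> R) (a b M : R) :
  0 < a ->
  (forall t, exists l, derivable_pt_lim F t l /\ l <= - a * F t + b) ->
  (forall t, F t <= M) -> forall t, F t <= b / a.
Proof.
  intros Ha H HM t0.
  set (G := fun t => proj1_sig (constructive_indefinite_description _ (H t))).
  assert (HF : forall t, derivable_pt_lim F t (G t))
    by (intros t; exact (proj1 (proj2_sig (constructive_indefinite_description _ (H t))))).
  assert (HG : forall t, G t <= - a * F t + b)
    by (intros t; exact (proj2 (proj2_sig (constructive_indefinite_description _ (H t))))).
  clearbody G. clear H.
  apply Rnot_lt_le. intros Hlt.
  set (eta := F t0 - b / a). assert (Heta : 0 < eta) by (unfold eta; lra).
  assert (D : forall s t, s <= t -> exp (a * t) * (F t - b / a) <= exp (a * s) * (F s - b / a)).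
  { apply (nonincreasing_of_deriv_nonpos (fun t => exp (a * t) * (F t - b / a))
      (fun t => exp (a * t) * a * (F t - b / a) + exp (a * t) * G t)).
    - intros t. apply (derivable_pt_lim_mult (fun t => exp (a * t)) (fun t => F t - b / a)).
      + apply (derivable_pt_lim_comp (fun t => a * t) exp).
        * eapply derivable_pt_lim_eq.
          -- apply (derivable_pt_lim_scal id a t 1), derivable_pt_lim_id.
          -- ring.
        * apply derivable_pt_lim_exp.
      + eapply derivable_pt_lim_eq.
        * apply (derivable_pt_lim_minus F (fun _ => b / a)); [apply HF|apply derivable_pt_lim_const].
        * ring.
    - intros t. specialize (HG t). pose proof (exp_pos (a * t)).
      assert (a * (F t - b / a) + G t <= 0) by (replace (a * (F t - b / a)) with (a * F t - b) by (field; lra); lra).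
      nra. }
  (* backwards in time [F - b/a] grows at least linearly *)
  set (d := (Rabs M + Rabs (b / a)) / (a * eta)).
  assert (Hd : 0 <= d).
  { apply Rmult_le_pos; [pose proof (Rabs_pos M); pose proof (Rabs_pos (b / a)); lra|].
    apply Rlt_le, Rinv_0_lt_compat. nra. }
  specialize (D (t0 - d) t0 ltac:(lra)). fold eta in D.
  replace (a * t0) with (a * (t0 - d) + a * d) in D by ring.
  rewrite exp_plus, Rmult_assoc in D. apply Rmult_le_reg_l in D; [|apply exp_pos].
  pose proof (HM (t0 - d)).
  assert (1 + a * d <= exp (a * d)).
  { destruct Hd as [Hd|<-].
    - apply Rlt_le, exp_ineq1. assert (0 < a * d) by nra. lra.
    - rewrite Rmult_0_r, exp_0. lra. }
  assert (a * d * eta = Rabs M + Rabs (b / a)) by (unfold d; field; lra).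
  pose proof (Rle_abs M). pose proof (Rle_abs (- (b / a))). rewrite Rabs_Ropp in *. nra.
Qed.

(** * Bounds on the attractor *)

Definition H2_bounded (L B : R) (c : coef) : Prop :=
  forall n, norm2 n c ^ 2 <= B /\ norm2 n (dx L (dx L c)) ^ 2 <= B.

Lemma Cnorm2_cscal (x : R) (z : C) : Cnorm2 (cscal x z) = x ^ 2 * Cnorm2 z.
Proof. unfold Cnorm2, cscal. simpl. ring. Qed.

Lemma norm2_dx_sq (L : R) (n : nat) (c : coef) :
  norm2 n (dx L c) ^ 2 = sumZ n (fun k => freq L k ^ 2 * Cnorm2 (c k)).
Proof. rewrite norm2_sq. apply sumZ_ext. intros. apply Cnorm2_cscal. Qed.

Lemma norm2_dxx_sq (L : R) (n : nat) (c : coef) :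
  norm2 n (dx L (dx L c)) ^ 2 = sumZ n (fun k => freq L k ^ 4 * Cnorm2 (c k)).
Proof.
  rewrite norm2_dx_sq. apply sumZ_ext. intros. unfold dx. rewrite Cnorm2_cscal. ring.
Qed.

Lemma H2_partial_eq (L : R) (c : coef) (n : nat) :
  H2_partial L c n = L * (norm2 n c ^ 2 + norm2 n (dx L (dx L c)) ^ 2).
Proof.
  unfold H2_partial. rewrite norm2_sq, norm2_dxx_sq, <- sumZ_plus. f_equal.
  apply sumZ_ext. intros. unfold wH2. ring.
Qed.

Lemma H2_bounded_of_partial (L M : R) (c : coef) :
  0 < L -> (forall n, H2_partial L c n <= M) -> H2_bounded L (M / L) c.
Proof.
  intros HL H n. specialize (H n). rewrite H2_partial_eq in H.
  assert (norm2 n c ^ 2 + norm2 n (dx L (dx L c)) ^ 2 <= M / L).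
  { apply Rmult_le_reg_l with L; [exact HL|].
    replace (L * (M / L)) with M by (field; lra). exact H. }
  pose proof (pow2_ge_0 (norm2 n c)). pose proof (pow2_ge_0 (norm2 n (dx L (dx L c)))). lra.
Qed.

Lemma wH2_nonneg (L : R) (k : Z) : 0 <= wH2 L k.
Proof.
  unfold wH2. replace (freq L k ^ 4) with ((freq L k ^ 2) ^ 2) by ring.
  pose proof (pow2_ge_0 (freq L k ^ 2)). lra.
Qed.

Lemma H2_partial_le_split (L : R) (a b : coef) (n : nat) : 0 < L ->
  H2_partial L a n <= 2 * H2_partial L (fun k => Csub (a k) (b k)) n + 2 * H2_partial L b n.
Proof.
  intros HL. unfold H2_partial.
  replace (2 * (L * sumZ n (fun k => wH2 L k * Cnorm2 (Csub (a k) (b k)))) +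
           2 * (L * sumZ n (fun k => wH2 L k * Cnorm2 (b k))))
    with (L * (2 * (sumZ n (fun k => wH2 L k * Cnorm2 (Csub (a k) (b k)))
           + sumZ n (fun k => wH2 L k * Cnorm2 (b k))))) by ring.
  apply Rmult_le_compat_l; [lra|].
  rewrite <- sumZ_plus, <- sumZ_scal. apply sumZ_le. intros k _.
  pose proof (wH2_nonneg L k).
  replace (2 * (wH2 L k * Cnorm2 (Csub (a k) (b k)) + wH2 L k * Cnorm2 (b k)))
    with (wH2 L k * (2 * (Cnorm2 (Csub (a k) (b k)) + Cnorm2 (b k)))) by ring.
  apply Rmult_le_compat_l; [assumption|].
  unfold Cnorm2, Csub. simpl fst. simpl snd.
  pose proof (pow2_ge_0 (fst (a k) - fst (b k) - fst (b k))).
  pose proof (pow2_ge_0 (snd (a k) - snd (b k) - snd (b k))). nra.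
Qed.

(** Otherwise some sequence in A has H^2 norms beyond every N, yet a convergent subsequence of it
    stays within distance 1 of its limit from some index on. *)
Lemma H2_compact_bounded (L : R) (A : coef -> Prop) :
  0 < L -> H2_compact L A -> exists M, forall c, A c -> forall n, H2_partial L c n <= M.
Proof.
  intros HL [HA Hc]. apply NNPP. intros Hno.
  assert (H : forall N : nat, exists c, A c /\ exists n, INR N < H2_partial L c n).
  { intros N. apply NNPP. intros H. apply Hno. exists (INR N). intros c Hc' n.
    apply Rnot_lt_le. intros Hlt. apply H. exists c. split; [exact Hc'|]. exists n. exact Hlt. }
  set (s := fun N => proj1_sig (constructive_indefinite_description _ (H N))).
  assert (Hs : forall N, A (s N) /\ exists n, INR N < H2_partial L (s N) n)
    by (intros N; exact (proj2_sig (constructive_indefinite_description _ (H N)))).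
  clearbody s. clear H.
  destruct (Hc s (fun N => proj1 (Hs N))) as [phi [a [Hphi [Ha Hconv]]]].
  destruct (HA a Ha) as [Ba HBa].
  destruct (Hconv 1 Rlt_0_1) as [N HN].
  destruct (INR_unbounded (2 * 1 + 2 * Ba)) as [N' HN'].
  set (j := Nat.max N N').
  assert (Hj : (j <= phi j)%nat).
  { clearbody j. induction j; [lia|]. specialize (Hphi j). lia. }
  destruct (proj2 (Hs (phi j))) as [n Hn].
  pose proof (HN j ltac:(lia) n) as Hd.
  pose proof (H2_partial_le_split L (s (phi j)) a n HL). pose proof (HBa n).
  assert (INR N' <= INR (phi j)) by (apply le_INR; lia). lra.
Qed.

(** Mode by mode, 2 x^2 <= 1 + x^4. *)
Lemma norm2_dx_le_H2 (L B : R) (c : coef) (n : nat) :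
  H2_bounded L B c -> norm2 n (dx L c) ^ 2 <= B.
Proof.
  intros H. destruct (H n) as [H1 H2].
  rewrite norm2_dx_sq. rewrite norm2_sq in H1. rewrite norm2_dxx_sq in H2.
  apply Rle_trans with (/2 * (sumZ n (fun k => Cnorm2 (c k)) + sumZ n (fun k => freq L k ^ 4 * Cnorm2 (c k)))).
  - rewrite <- sumZ_plus, <- sumZ_scal. apply sumZ_le. intros k _.
    pose proof (Cnorm2_nonneg (c k)). pose proof (pow2_ge_0 (freq L k ^ 2 - 1)). nra.
  - lra.
Qed.

Lemma H2_bounded_nonneg (L B : R) (c : coef) : H2_bounded L B c -> 0 <= B.
Proof. intros H. destruct (H O). pose proof (pow2_ge_0 (norm2 0 c)). lra. Qed.

Lemma norm1_le_H2 (L B : R) : 0 < L ->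
  exists S, 0 <= S /\ forall c, H2_bounded L B c -> forall n, norm1 n c <= S.
Proof.
  intros HL. destruct (norm1_interp L 1 HL Rlt_0_1) as [C0 [HC0 HC]].
  exists (sqrt (C0 * B + 1 * B)). split; [apply sqrt_pos|]. intros c Hc n.
  pose proof (H2_bounded_nonneg _ _ _ Hc). pose proof (norm2_dx_le_H2 L B c n Hc).
  destruct (Hc n) as [H1 _].
  rewrite <- (sqrt_pow2 (norm1 n c)) by apply norm1_nonneg.
  apply sqrt_le_1_alt. eapply Rle_trans; [apply HC|].
  apply Rplus_le_compat; apply Rmult_le_compat_l; lra.
Qed.

(** The second derivative gives the factor 1/N; the extra N^(-1/2) of the tail bound is discarded.
    The rate 1/N is enough, because its square is later summed over 2N + 1 modes. *)
Lemma norm1_high_le (L B : R) (c : coef) (N n : nat) :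
  0 < L -> (1 <= N)%nat -> H2_bounded L B c ->
  norm1 n (sub c (lowp N c)) <= sqrt 2 * sqrt B / (2 * PI / L) ^ 2 / INR N.
Proof.
  intros HL HN Hc. pose proof (lam_pos L HL) as Hl.
  assert (HN1 : 1 <= INR N) by (apply (le_INR 1); exact HN).
  eapply Rle_trans; [apply (norm1_tail_le L N); auto; intros; apply highp_low; assumption|].
  set (lam := 2 * PI / L) in *.
  assert (H1 : norm2 n (dx L (sub c (lowp N c))) <= / (lam * INR N) * norm2 n (dx L (dx L c))).
  { rewrite <- (Rabs_pos_eq (/ (lam * INR N))) by (apply Rlt_le, Rinv_0_lt_compat; nra).
    unfold norm2 at 2. rewrite <- l2_scal. unfold norm2. apply l2_le. intros k _.
    unfold dx at 1. rewrite cmod_cscal. rewrite !Rpow_mult_distr, pow2_abs.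
    destruct (Z.le_gt_cases (Z.abs k) (Z.of_nat N)) as [h|h].
    - rewrite highp_low by exact h. rewrite cmod_zero.
      replace (freq L k ^ 2 * 0 ^ 2) with 0 by ring. apply Rmult_le_pos; apply pow2_ge_0.
    - unfold dx. rewrite !cmod_cscal, !Rpow_mult_distr, !pow2_abs.
      assert (cmod (sub c (lowp N c) k) ^ 2 <= cmod (c k) ^ 2)
        by (apply pow_incr; split; [apply cmod_nonneg|apply cmod_highp_le]).
      assert (1 <= (/ (lam * INR N)) ^ 2 * freq L k ^ 2).
      { rewrite freq_mult. fold lam.
        replace ((/ (lam * INR N)) ^ 2 * (lam * IZR k) ^ 2) with (IZR k ^ 2 / INR N ^ 2)
          by (field; lra).
        apply Rmult_le_reg_r with (INR N ^ 2); [nra|].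
        unfold Rdiv. rewrite Rmult_assoc, Rinv_l by nra. rewrite Rmult_1_l, Rmult_1_r.
        rewrite <- (pow2_abs (IZR k)), <- abs_IZR. apply pow_incr. split; [lra|].
        rewrite INR_IZR_INZ. apply IZR_le. lia. }
      pose proof (pow2_ge_0 (freq L k)). pose proof (pow2_ge_0 (cmod (c k))).
      assert (0 <= freq L k ^ 2 * cmod (c k) ^ 2) by (apply Rmult_le_pos; assumption). nra. }
  assert (H2 : norm2 n (dx L (dx L c)) <= sqrt B).
  { destruct (Hc n) as [_ H2]. rewrite <- (sqrt_pow2 (norm2 n (dx L (dx L c)))) by apply norm2_nonneg.
    apply sqrt_le_1_alt. exact H2. }
  assert (H3 : sqrt (2 / INR N) <= sqrt 2).
  { apply sqrt_le_1_alt. apply Rmult_le_reg_r with (INR N); [lra|].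
    unfold Rdiv. rewrite Rmult_assoc, Rinv_l by lra. lra. }
  assert (Hi : 0 <= / (lam * INR N)) by (apply Rlt_le, Rinv_0_lt_compat; nra).
  apply Rle_trans with (sqrt 2 / lam * (/ (lam * INR N) * sqrt B)).
  - apply Rmult_le_compat.
    + apply Rmult_le_pos; [apply sqrt_pos|apply Rlt_le, Rinv_0_lt_compat; exact Hl].
    + apply norm2_nonneg.
    + apply Rmult_le_compat_r; [apply Rlt_le, Rinv_0_lt_compat; exact Hl|exact H3].
    + eapply Rle_trans; [exact H1|]. apply Rmult_le_compat_l; assumption.
  - right. field. lra.
Qed.

(** * Galerkin truncation *)

Lemma limit_dist_le (u : nat -> R) (l x e : R) (N : nat) :
  Un_cv u l -> (forall n, (N <= n)%nat -> Rabs (u n - x) <= e) -> Rabs (l - x) <= e.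
Proof.
  intros Hu H. apply Rnot_lt_le. intros Hlt.
  destruct (Hu (Rabs (l - x) - e)) as [N' HN']; [lra|].
  set (n := Nat.max N N').
  specialize (HN' n ltac:(lia)). specialize (H n ltac:(lia)).
  unfold Rdist in HN'.
  pose proof (Rabs_triang (l - u n) (u n - x)) as T.
  replace (l - u n + (u n - x)) with (l - x) in T by ring.
  rewrite (Rabs_minus_sym l (u n)) in T. lra.
Qed.

Lemma cmod_term_le (n : nat) (x : coef) (k : Z) (S : R) :
  (forall n, norm1 n x <= S) -> cmod (x k) <= S.
Proof.
  intros H. eapply Rle_trans; [|apply (H (Z.abs_nat k))].
  apply (sumZ_term (Z.abs_nat k) (fun k => cmod (x k))); [intros; apply cmod_nonneg|lia].
Qed.

(** The three factors are replaced one at a time. *)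
Lemma cmod_cub_diff_le (a b c a' b' c' : C) :
  cmod a' <= cmod a -> cmod b' <= cmod b ->
  cmod (Csub (cub a b c) (cub a' b' c'))
  <= cmod (Csub a a') * cmod b * cmod c + cmod a * cmod (Csub b b') * cmod c
     + cmod a * cmod b * cmod (Csub c c').
Proof.
  intros Ha Hb.
  replace (Csub (cub a b c) (cub a' b' c'))
    with (Cadd (Cadd (cub (Csub a a') b c) (cub a' (Csub b b') c)) (cub a' b' (Csub c c')))
    by (unfold Cadd, Csub, cub, Cmul, Cconj; simpl; f_equal; ring).
  pose proof (cmod_Cadd (Cadd (cub (Csub a a') b c) (cub a' (Csub b b') c)) (cub a' b' (Csub c c'))).
  pose proof (cmod_Cadd (cub (Csub a a') b c) (cub a' (Csub b b') c)).
  rewrite !cmod_cub in *.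
  pose proof (cmod_nonneg (Csub b b')). pose proof (cmod_nonneg (Csub c c')).
  pose proof (cmod_nonneg a'). pose proof (cmod_nonneg b'). pose proof (cmod_nonneg c).
  assert (cmod a' * cmod (Csub b b') * cmod c <= cmod a * cmod (Csub b b') * cmod c).
  { apply Rmult_le_compat_r; [assumption|]. apply Rmult_le_compat_r; assumption. }
  assert (cmod a' * cmod b' * cmod (Csub c c') <= cmod a * cmod b * cmod (Csub c c')).
  { apply Rmult_le_compat_r; [assumption|]. apply Rmult_le_compat; assumption. }
  lra.
Qed.

(* [p] is one of the two coordinates [fst], [snd]. *)
Lemma cubic_truncation (p : C -> R) (c : coef) (N n' : nat) (k : Z) (S tau : R) :
  p (0, 0) = 0 -> (forall z w, Rabs (p z - p w) <= cmod (Csub z w)) ->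
  (forall n, norm1 n c <= S) -> (forall n, norm1 n (sub c (lowp N c)) <= tau) ->
  (Z.abs k <= Z.of_nat N)%Z -> (N <= n')%nat ->
  Rabs (sumZ n' (fun k1 => sumZ n' (fun k2 => p (cubic_term c k k1 k2)))
        - sum3 N (fun k1 k2 k3 => resonance k1 k2 k3 k * p (cub (c k1) (c k2) (c k3))))
  <= 3 * S ^ 2 * tau.
Proof.
  intros Hp0 Hp HS Htau Hk Hn.
  (* The resonance leaves only k3 = k - k1 + k2, so the Galerkin sum is the square partial sum
     formed with [lowp N c]. *)
  assert (E : sum3 N (fun k1 k2 k3 => resonance k1 k2 k3 k * p (cub (c k1) (c k2) (c k3)))
    = sumZ n' (fun k1 => sumZ n' (fun k2 =>
        p (cub (lowp N c k1) (lowp N c k2) (lowp N c (k - k1 + k2)%Z))))).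
  { assert (Z1 : forall b d, cub (0, 0) b d = (0, 0))
      by (intros; unfold cub, Cmul, Cconj; simpl; f_equal; ring).
    assert (Z2 : forall b d, cub b (0, 0) d = (0, 0))
      by (intros; unfold cub, Cmul, Cconj; simpl; f_equal; ring).
    assert (Z3 : forall b d, cub b d (0, 0) = (0, 0))
      by (intros; unfold cub, Cmul, Cconj; simpl; f_equal; ring).
    assert (out : forall j, (Z.of_nat N < Z.abs j)%Z -> lowp N c j = (0, 0))
      by (intros j Hj; unfold lowp; destruct (Z.leb_spec (Z.abs j) (Z.of_nat N)); [lia|reflexivity]).
    rewrite (sumZ_support N n').
    2:{ exact Hn. }
    2:{ intros j Hj. rewrite (out j Hj).
        rewrite (sumZ_ext n' _ (fun _ => 0)); [apply sumZ_zero|].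
        intros. rewrite Z1. exact Hp0. }
    apply sumZ_ext. intros k1 H1.
    rewrite (sumZ_support N n').
    2:{ exact Hn. }
    2:{ intros j Hj. rewrite (out j Hj). rewrite Z2. exact Hp0. }
    apply sumZ_ext. intros k2 H2.
    rewrite (sumZ_ext N _ (fun k3 => if (k3 =? k - k1 + k2)%Z
                                     then p (cub (c k1) (c k2) (c (k - k1 + k2)%Z)) else 0)).
    - rewrite sumZ_single. unfold lowp.
      destruct (Z.leb_spec (Z.abs k1) (Z.of_nat N)); [|lia].
      destruct (Z.leb_spec (Z.abs k2) (Z.of_nat N)); [|lia].
      destruct Z.leb; [reflexivity|]. rewrite Z3. symmetry. exact Hp0.
    - intros k3 _. rewrite (resonance_single _ _ _ _ k3 (k - k1 + k2)%Z) by lia.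
      destruct (Z.eqb_spec k3 (k - k1 + k2)); [subst|]; ring. }
  rewrite E. clear E.
  set (y := sub c (lowp N c)) in *.
  assert (HS0 : 0 <= S) by (eapply Rle_trans; [apply (norm1_nonneg 0 c)|apply HS]).
  assert (Ht0 : 0 <= tau) by (eapply Rle_trans; [apply (norm1_nonneg 0 y)|apply Htau]).
  replace (sumZ n' (fun k1 => sumZ n' (fun k2 => p (cubic_term c k k1 k2)))
           - sumZ n' (fun k1 => sumZ n' (fun k2 =>
        p (cub (lowp N c k1) (lowp N c k2) (lowp N c (k - k1 + k2)%Z)))))
    with (sumZ n' (fun k1 => sumZ n' (fun k2 => p (cubic_term c k k1 k2)
        + -1 * p (cub (lowp N c k1) (lowp N c k2) (lowp N c (k - k1 + k2)%Z))))).
  2:{ rewrite (sumZ_ext n' _ (fun k1 => sumZ n' (fun k2 => p (cubic_term c k k1 k2))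
        + -1 * sumZ n' (fun k2 => p (cub (lowp N c k1) (lowp N c k2) (lowp N c (k - k1 + k2)%Z))))).
      - rewrite sumZ_plus, sumZ_scal. ring.
      - intros. rewrite sumZ_plus, sumZ_scal. reflexivity. }
  (* The third index is tied to k1 and k2, so that factor is bounded by its supremum, and the two
     free sums become Wiener norms. *)
  apply Rle_trans with (sumZ n' (fun k1 => sumZ n' (fun k2 =>
     S * (cmod (y k1) * cmod (c k2)) + S * (cmod (c k1) * cmod (y k2))
     + tau * (cmod (c k1) * cmod (c k2))))).
  - eapply Rle_trans; [apply sumZ_abs|]. apply sumZ_le. intros k1 _.
    eapply Rle_trans; [apply sumZ_abs|]. apply sumZ_le. intros k2 _.
    replace (p (cubic_term c k k1 k2) + -1 * p (cub (lowp N c k1) (lowp N c k2) (lowp N c (k - k1 + k2)%Z)))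
      with (p (cubic_term c k k1 k2) - p (cub (lowp N c k1) (lowp N c k2) (lowp N c (k - k1 + k2)%Z))) by ring.
    eapply Rle_trans; [apply Hp|].
    change (cubic_term c k k1 k2) with (cub (c k1) (c k2) (c (k - k1 + k2)%Z)).
    eapply Rle_trans; [apply cmod_cub_diff_le; apply cmod_lowp_le|].
    change (Csub (c k1) (lowp N c k1)) with (y k1).
    change (Csub (c k2) (lowp N c k2)) with (y k2).
    change (Csub (c (k - k1 + k2)%Z) (lowp N c (k - k1 + k2)%Z)) with (y (k - k1 + k2)%Z).
    pose proof (cmod_term_le 0 c (k - k1 + k2)%Z S HS).
    pose proof (cmod_term_le 0 y (k - k1 + k2)%Z tau Htau).
    pose proof (cmod_nonneg (c k1)). pose proof (cmod_nonneg (c k2)).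
    pose proof (cmod_nonneg (y k1)). pose proof (cmod_nonneg (y k2)).
    assert (forall a b s t, 0 <= a -> 0 <= b -> s <= t -> a * b * s <= t * (a * b)) as M.
    { intros a b s t H5 H6 H7. rewrite (Rmult_comm t).
      apply Rmult_le_compat_l; [apply Rmult_le_pos; assumption|assumption]. }
    repeat apply Rplus_le_compat; apply M; assumption.
  - rewrite (sumZ_ext n' _ (fun k1 => (S * norm1 n' c) * cmod (y k1)
        + (S * norm1 n' y + tau * norm1 n' c) * cmod (c k1))).
    + rewrite sumZ_plus, !sumZ_scal. fold (norm1 n' c) (norm1 n' y).
      pose proof (HS n'). pose proof (Htau n').
      pose proof (norm1_nonneg n' c). pose proof (norm1_nonneg n' y).
      assert (norm1 n' c * norm1 n' y <= S * tau) by (apply Rmult_le_compat; assumption).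
      assert (norm1 n' c * norm1 n' c <= S * S) by (apply Rmult_le_compat; assumption).
      assert (S * (norm1 n' c * norm1 n' y) <= S * (S * tau)) by (apply Rmult_le_compat_l; assumption).
      assert (tau * (norm1 n' c * norm1 n' c) <= tau * (S * S)) by (apply Rmult_le_compat_l; assumption).
      nra.
    + intros k1 _. rewrite !sumZ_plus, !sumZ_scal. fold (norm1 n' c) (norm1 n' y). ring.
Qed.

(* Gradient of the Hamiltonian 1/2|u_x|^2 - 1/4|u|^4 + Re(f conj u) on P_n. *)
Definition grad (L : R) (f : coef) (n : nat) (c : coef) : coef := fun k =>
  Cadd (Csub (dx L (dx L c) k) (tri n c c c k)) (f k).

Definition rot (z : C) : C := (snd z, - fst z).

(* The equation reads i (u' + gamma u) = grad u - r, with r the truncation error. *)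
Definition velocity (gamma : R) (c g r : coef) : coef := fun k =>
  Cadd (cscal (- gamma) (c k)) (rot (Csub (g k) (r k))).

(** Only the size of the defect is recorded: r is chosen separately at each time, with no continuity
    in t. *)
Definition galerkin (L gamma : R) (f : coef) (n : nat) (u : R -> coef) (e : R) : Prop :=
  forall t, exists r, norm2 n r <= e /\
    path_deriv n u t (velocity gamma (u t) (grad L f n (u t)) r).

Lemma fst_dist_le (z w : C) : Rabs (fst z - fst w) <= cmod (Csub z w).
Proof.
  apply Rabs_le_of_sq; [apply cmod_nonneg|]. rewrite cmod_sq. unfold Cnorm2, Csub.
  simpl fst. simpl snd. pose proof (pow2_ge_0 (snd z - snd w)). lra.
Qed.

Lemma snd_dist_le (z w : C) : Rabs (snd z - snd w) <= cmod (Csub z w).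
Proof.
  apply Rabs_le_of_sq; [apply cmod_nonneg|]. rewrite cmod_sq. unfold Cnorm2, Csub.
  simpl fst. simpl snd. pose proof (pow2_ge_0 (fst z - fst w)). lra.
Qed.

Lemma sq_le_of_abs (x y : R) : Rabs x <= y -> x ^ 2 <= y ^ 2.
Proof. intros H. rewrite <- (pow2_abs x). apply pow_incr. split; [apply Rabs_pos|exact H]. Qed.

Lemma galerkin_error_le (L B : R) : 0 < L ->
  exists K, 0 <= K /\ forall c z n, (1 <= n)%nat -> H2_bounded L B c ->
    (forall k, (Z.abs k <= Z.of_nat n)%Z -> cubic_coef c k (z k)) ->
    norm2 n (fun k => Csub (z k) (tri n c c c k)) ^ 2 <= K / INR n.
Proof.
  intros HL. destruct (norm1_le_H2 L B HL) as [S [HS0 HS]].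
  set (D := sqrt 2 * sqrt B / (2 * PI / L) ^ 2).
  (* 6 = 2 * 3: two coordinates per mode, and 2n + 1 <= 3n modes, each with an error of order
     1/n. *)
  exists (6 * (3 * S ^ 2 * D) ^ 2). split; [pose proof (pow2_ge_0 (3 * S ^ 2 * D)); lra|].
  intros c z n Hn Hc Hz.
  assert (Hn1 : 1 <= INR n) by (apply (le_INR 1); exact Hn).
  assert (Htau : forall j, norm1 j (sub c (lowp n c)) <= D / INR n)
    by (intros j; apply (norm1_high_le L B c n j HL Hn Hc)).
  set (e := 3 * S ^ 2 * (D / INR n)).
  apply Rle_trans with (sumZ n (fun _ => 2 * e ^ 2)).
  - rewrite norm2_sq. apply sumZ_le. intros k Hk.
    destruct (Hz k Hk) as [H1 H2].
    assert (E1 : Rabs (fst (z k) - fst (tri n c c c k)) <= e).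
    { apply (limit_dist_le _ _ _ _ n H1). intros n' Hn'.
      apply (cubic_truncation (fun z => fst z) c n n' k); auto; intros; apply fst_dist_le. }
    assert (E2 : Rabs (snd (z k) - snd (tri n c c c k)) <= e).
    { apply (limit_dist_le _ _ _ _ n H2). intros n' Hn'.
      apply (cubic_truncation (fun z => snd z) c n n' k); auto; intros; apply snd_dist_le. }
    apply sq_le_of_abs in E1, E2.
    change ((fst (z k) - fst (tri n c c c k)) ^ 2 + (snd (z k) - snd (tri n c c c k)) ^ 2 <= 2 * e ^ 2).
    lra.
  - rewrite sumZ_const.
    replace (6 * (3 * S ^ 2 * D) ^ 2 / INR n) with (3 * INR n * (2 * e ^ 2))
      by (unfold e; field; lra).
    apply Rmult_le_compat_r; [pose proof (pow2_ge_0 e); lra|lra].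
Qed.

Lemma galerkin_approx (L gamma B : R) (f : coef) (u : R -> coef) : 0 < L ->
  (forall t, H2_bounded L B (u t)) -> nls_complete_sol L gamma f u ->
  forall e, 0 < e -> exists n0, forall n, (n0 <= n)%nat -> galerkin L gamma f n u e.
Proof.
  intros HL Hb Hu e He.
  destruct (galerkin_error_le L B HL) as [K [HK0 HK]].
  destruct (INR_archimed (e ^ 2) K (pow_lt e 2 He)) as [N HN].
  exists (S N). intros n Hn t.
  assert (Hn1 : 1 <= INR n) by (apply (le_INR 1); lia).
  assert (HNn : INR N <= INR n) by (apply le_INR; lia).
  (* The equation is available on open intervals (-T, T) only, hence a T strictly above |t|. *)
  destruct (Hu (Rabs t + 1)) as [_ [_ [_ H]]]; [pose proof (Rabs_pos t); lra|].
  assert (Ht : - (Rabs t + 1) < t < Rabs t + 1).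
  { pose proof (Rle_abs t). pose proof (Rle_abs (- t)). rewrite Rabs_Ropp in *. lra. }
  specialize (H t Ht).
  set (z := fun k => proj1_sig (constructive_indefinite_description _ (proj2_sig
              (constructive_indefinite_description _ (H k))))).
  set (d := fun k => proj1_sig (constructive_indefinite_description _ (H k))).
  assert (Hzd : forall k, derivable_pt_lim (fun s => fst (u s k)) t (fst (d k)) /\
     derivable_pt_lim (fun s => snd (u s k)) t (snd (d k)) /\
     cubic_coef (u t) k (z k) /\ nls_mode L gamma f (u t) k (d k) (z k))
    by (intros k; exact (proj2_sig (constructive_indefinite_description _ (proj2_sig
              (constructive_indefinite_description _ (H k)))))).
  clearbody z d. clear H.
  exists (fun k => Csub (z k) (tri n (u t) (u t) (u t) k)). split.
  - rewrite <- (sqrt_pow2 e) by lra.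
    rewrite <- (sqrt_pow2 (norm2 n _)) by apply norm2_nonneg.
    apply sqrt_le_1_alt.
    eapply Rle_trans; [apply HK; [lia|apply Hb|]|].
    + intros k _. apply Hzd.
    + apply Rmult_le_reg_r with (INR n); [lra|].
      unfold Rdiv. rewrite Rmult_assoc, Rinv_l by lra. nra.
  - intros k _. destruct (Hzd k) as [H1 [H2 [_ H3]]].
    assert (E : velocity gamma (u t) (grad L f n (u t)) (fun k => Csub (z k) (tri n (u t) (u t) (u t) k)) k = d k).
    { unfold nls_mode in H3. unfold velocity, grad. rewrite <- H3.
      unfold rot, dx, cscal, Csub, Cadd, Cmul, Ci, RtoC. destruct (d k). simpl. f_equal; ring. }
    rewrite E. split; assumption.
Qed.

(** * A priori bounds *)

Definition zeroc : coef := fun _ => (0, 0).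
Definition rotc (x : coef) : coef := fun k => rot (x k).

Ltac ip_ext :=
  unfold ip; rewrite <- ?sumZ_scal, <- ?sumZ_plus; apply sumZ_ext; intros;
  unfold rotc, sub, grad, velocity, dx, zeroc, rdot, rot, cscal, Cadd, Csub, Cmul, Ci; simpl.

Lemma ip_comm (n : nat) (x y : coef) : ip n x y = ip n y x.
Proof. ip_ext. ring. Qed.

Lemma ip_sub_l (n : nat) (x y z : coef) : ip n (sub x y) z = ip n x z + -1 * ip n y z.
Proof. ip_ext. ring. Qed.

Lemma ip_rotc_self (n : nat) (x : coef) : ip n x (rotc x) = 0.
Proof. rewrite <- (sumZ_zero n). ip_ext. ring. Qed.

Lemma ip_velocity (gamma : R) (n : nat) (x c g r : coef) :
  ip n x (velocity gamma c g r) = - gamma * ip n x c + ip n x (rotc g) + -1 * ip n x (rotc r).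
Proof. ip_ext. ring. Qed.

Lemma ip_grad (L : R) (f : coef) (n : nat) (c x : coef) :
  ip n (grad L f n c) x = ip n (dx L c) (dx L x) + -1 * Q n c c c x + ip n f x.
Proof.
  rewrite <- ip_tri. unfold ip. rewrite <- sumZ_scal, <- !sumZ_plus. apply sumZ_ext. intros.
  unfold rdot, grad, dx, cscal, Cadd, Csub. cbn -[tri]. ring.
Qed.

Lemma norm2_rotc (n : nat) (x : coef) : norm2 n (rotc x) = norm2 n x.
Proof.
  unfold norm2, l2. f_equal. apply sumZ_ext. intros. rewrite !cmod_sq.
  unfold rotc, rot, Cnorm2. simpl. ring.
Qed.

Lemma ip_rotc_le (n : nat) (x y : coef) : Rabs (ip n x (rotc y)) <= norm2 n x * norm2 n y.
Proof. rewrite <- (norm2_rotc n y). apply ip_le. Qed.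

(** The dispersive part drops out because its symbol is real, the cubic part by [Q_i_self]; only the
    forcing changes the mass. *)
Lemma ip_self_rot_grad (L : R) (f : coef) (n : nat) (c : coef) :
  ip n c (rotc (grad L f n c)) = ip n c (rotc f).
Proof.
  transitivity (ip n c (rotc f) + -1 * ip n c (rotc (tri n c c c))).
  - unfold ip. rewrite <- sumZ_scal, <- !sumZ_plus. apply sumZ_ext. intros.
    unfold rotc, rot, rdot, grad, dx, cscal, Cadd, Csub. cbn -[tri]. ring.
  - replace (ip n c (rotc (tri n c c c))) with (ip n (tri n c c c) (fun k => Cmul Ci (c k))).
    + rewrite ip_tri, Q_i_self. ring.
    + unfold ip. apply sumZ_ext. intros. unfold rdot, rotc, rot, Cmul, Ci. cbn -[tri]. ring.
Qed.

Lemma Rabs_le_inv (x y : R) : Rabs x <= y -> - y <= x <= y.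
Proof. intros H. pose proof (Rle_abs x). pose proof (Rle_abs (- x)). rewrite Rabs_Ropp in *. lra. Qed.

Lemma pow2_le_inv (x y : R) : 0 <= y -> x ^ 2 <= y ^ 2 -> x <= y.
Proof. intros Hy H. apply (Rabs_le_inv x y), Rabs_le_of_sq; assumption. Qed.

(** The mass balance is -2 gamma |u|^2 plus at most 2 |u| (phi + e). Young with weight gamma leaves
    the rate gamma and the source (phi + e)^2 / gamma, whose quotient is the square of the claimed
    bound. *)
Lemma L2_bound (L gamma phi e M : R) (f : coef) (n : nat) (u : R -> coef) :
  0 < gamma -> 0 <= phi -> 0 <= e -> norm2 n f <= phi ->
  galerkin L gamma f n u e -> (forall t, norm2 n (u t) ^ 2 <= M) ->
  forall t, norm2 n (u t) <= (phi + e) / gamma.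
Proof.
  intros Hg Hphi He Hf Hu HM t.
  apply pow2_le_inv; [apply Rmult_le_pos; [lra|apply Rlt_le, Rinv_0_lt_compat; exact Hg]|].
  rewrite <- ip_self.
  replace (((phi + e) / gamma) ^ 2) with ((phi + e) ^ 2 / gamma / gamma) by (field; lra).
  apply (gronwall_line (fun t => ip n (u t) (u t)) gamma ((phi + e) ^ 2 / gamma) M Hg).
  2:{ intros s. rewrite ip_self. apply HM. }
  clear t. intros t. destruct (Hu t) as [r [Hr Hd]].
  eexists. split; [apply (ip_derivable n u u t); exact Hd|].
  rewrite (ip_comm n _ (u t)), ip_velocity, ip_self_rot_grad, ip_self.
  pose proof (Rabs_le_inv _ _ (ip_rotc_le n (u t) f)).
  pose proof (Rabs_le_inv _ _ (ip_rotc_le n (u t) r)).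
  pose proof (norm2_nonneg n (u t)). set (X := norm2 n (u t)) in *.
  assert (X * norm2 n f <= X * phi) by (apply Rmult_le_compat_l; assumption).
  assert (X * norm2 n r <= X * e) by (apply Rmult_le_compat_l; assumption).
  assert (2 * (X * (phi + e)) <= gamma * X ^ 2 + (phi + e) ^ 2 / gamma) by (apply young; exact Hg).
  lra.
Qed.

Lemma path_deriv_dx (L : R) (n : nat) (u : R -> coef) (t : R) (d : coef) :
  path_deriv n u t d -> path_deriv n (fun s => dx L (u s)) t (dx L d).
Proof. intros H k Hk. apply (cderiv_cscal (freq L k) (fun s => u s k)). auto. Qed.

Definition energy (L : R) (f : coef) (n : nat) (c : coef) : R :=
  / 2 * ip n (dx L c) (dx L c) - / 4 * Q n c c c c + ip n f c.

Lemma Q_derivable_diag (n : nat) (u : R -> coef) (t : R) (d : coef) :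
  path_deriv n u t d ->
  derivable_pt_lim (fun s => / 4 * Q n (u s) (u s) (u s) (u s)) t (Q n (u t) (u t) (u t) d).
Proof.
  intros H. eapply derivable_pt_lim_eq.
  - apply (derivable_pt_lim_scal (fun s => Q n (u s) (u s) (u s) (u s))).
    apply (Q_derivable n u u u u t); exact H.
  - rewrite (Q_conj n d), (Q_swap24 n (u t) d), (Q_conj n (u t) (u t) d). field.
Qed.

Lemma energy_derivable (L : R) (f : coef) (n : nat) (u : R -> coef) (t : R) (d : coef) :
  path_deriv n u t d ->
  derivable_pt_lim (fun s => energy L f n (u s)) t (ip n (grad L f n (u t)) d).
Proof.
  intros H. unfold energy.
  pose proof (path_deriv_dx L n u t d H) as Hx.
  eapply derivable_pt_lim_eq.
  - apply (derivable_pt_lim_plus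
      (fun s => / 2 * ip n (dx L (u s)) (dx L (u s)) - / 4 * Q n (u s) (u s) (u s) (u s))
      (fun s => ip n f (u s))).
    + apply (derivable_pt_lim_minus
        (fun s => / 2 * ip n (dx L (u s)) (dx L (u s)))).
      * apply (derivable_pt_lim_scal (fun s => ip n (dx L (u s)) (dx L (u s)))).
        apply (ip_derivable n (fun s => dx L (u s)) (fun s => dx L (u s)) t); exact Hx.
      * apply Q_derivable_diag. exact H.
    + apply (ip_derivable n (fun _ => f) u t zeroc d); [|exact H].
      intros k _. apply cderiv_const.
  - rewrite ip_grad, (ip_comm n (dx L d)).
    assert (ip n zeroc (u t) = 0) as -> by (rewrite <- (sumZ_zero n); ip_ext; ring).
    field.
Qed.

(** Since [rot] is skew, the energy changes at the rate -gamma times the pairing of the gradient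
    with u, up to the defect. That pairing equals the energy plus |u_x|^2 / 2 - 3 Q / 4, and
    interpolation lets |u_x|^2 absorb Q. R1 is fixed before G and M, which carry the dependence on
    the attractor. *)
Lemma H1_bound (L gamma phi : R) : 0 < L -> 0 < gamma -> 0 <= phi ->
  exists R1, 0 <= R1 /\ forall f u n e G M,
    0 <= e <= 1 -> norm2 n f <= phi -> galerkin L gamma f n u e ->
    (forall t, norm2 n (grad L f n (u t)) <= G) -> e * G <= 1 ->
    (forall t, norm2 n (u t) ^ 2 <= M) -> (forall t, energy L f n (u t) <= M) ->
    forall t, norm2 n (dx L (u t)) <= R1.
Proof.
  intros HL Hg Hphi.
  set (R0 := (phi + 1) / gamma).
  assert (HR0 : 0 < R0) by (apply Rdiv_lt_0_compat; lra).
  assert (HR02 : 0 < R0 ^ 2) by (apply pow_lt; exact HR0).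
  assert (Heps : 0 < / (3 * R0 ^ 2)) by (apply Rinv_0_lt_compat; lra).
  (* After multiplication by |u|^2 <= R0^2 the coefficient of |u_x|^2 in the bound for Q is 1/3, so
     that 3/4 of it stays below 1/2. *)
  destruct (norm1_interp L (/ (3 * R0 ^ 2)) HL Heps) as [C0 [HC0 HC]].
  set (K := C0 * R0 ^ 4).
  assert (HK : 0 <= K) by (apply Rmult_le_pos; [exact HC0|apply pow_le; lra]).
  set (beta := 1 + gamma * K).
  assert (Hbeta : 0 <= beta / gamma).
  { apply Rmult_le_pos; [unfold beta; nra|apply Rlt_le, Rinv_0_lt_compat; exact Hg]. }
  assert (HphiR : 0 <= phi * R0) by nra.
  exists (sqrt (4 * (beta / gamma + K + phi * R0))). split; [apply sqrt_pos|].
  intros f u n e G M [He0 He1] Hf Hu HG HeG HM HE.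
  assert (H0 : forall t, norm2 n (u t) <= R0).
  { intros t. eapply Rle_trans; [apply (L2_bound L gamma phi e M f n u); assumption|].
    apply Rmult_le_compat_r; [apply Rlt_le, Rinv_0_lt_compat; exact Hg|lra]. }
  assert (HQ : forall t, Rabs (Q n (u t) (u t) (u t) (u t)) <= K + / 3 * norm2 n (dx L (u t)) ^ 2).
  { intros t. eapply Rle_trans; [apply Q_le|].
    pose proof (HC n (u t)) as HCt. specialize (H0 t).
    pose proof (norm2_nonneg n (u t)) as HX.
    assert (HX2 : norm2 n (u t) ^ 2 <= R0 ^ 2) by (apply pow_incr; lra).
    pose proof (pow2_ge_0 (norm2 n (u t))). pose proof (pow2_ge_0 (norm2 n (dx L (u t)))).
    pose proof (pow2_ge_0 (norm1 n (u t))).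
    replace (norm1 n (u t) * norm1 n (u t) * norm2 n (u t) * norm2 n (u t))
      with (norm1 n (u t) ^ 2 * norm2 n (u t) ^ 2) by ring.
    replace (K + / 3 * norm2 n (dx L (u t)) ^ 2)
      with ((C0 * R0 ^ 2 + / (3 * R0 ^ 2) * norm2 n (dx L (u t)) ^ 2) * R0 ^ 2)
      by (unfold K; field; lra).
    apply Rmult_le_compat; try assumption.
    eapply Rle_trans; [exact HCt|]. apply Rplus_le_compat_r. apply Rmult_le_compat_l; assumption. }
  assert (Hfu : forall t, Rabs (ip n f (u t)) <= phi * R0).
  { intros t. eapply Rle_trans; [apply ip_le|].
    apply Rmult_le_compat; try apply norm2_nonneg; auto. }
  assert (HF : forall t, energy L f n (u t) <= beta / gamma).
  { apply (gronwall_line (fun t => energy L f n (u t)) gamma beta M Hg); [|exact HE].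
    intros t. destruct (Hu t) as [r [Hr Hd]].
    eexists. split; [apply energy_derivable; exact Hd|].
    rewrite ip_velocity, ip_rotc_self, ip_grad, ip_self. unfold energy. rewrite ip_self.
    pose proof (Rabs_le_inv _ _ (ip_rotc_le n (grad L f n (u t)) r)) as Hr'.
    assert (norm2 n (grad L f n (u t)) * norm2 n r <= 1).
    { apply Rle_trans with (G * e); [|lra].
      apply Rmult_le_compat; try apply norm2_nonneg; auto. }
    pose proof (Rabs_le_inv _ _ (HQ t)). pose proof (pow2_ge_0 (norm2 n (dx L (u t)))).
    assert (gamma * (3 / 4 * Q n (u t) (u t) (u t) (u t) - / 2 * norm2 n (dx L (u t)) ^ 2)
            <= gamma * K) by (apply Rmult_le_compat_l; lra).
    unfold beta. lra. }
  intros t. rewrite <- (sqrt_pow2 (norm2 n (dx L (u t)))) by apply norm2_nonneg.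
  apply sqrt_le_1_alt.
  specialize (HF t). unfold energy in HF. rewrite ip_self in HF.
  pose proof (Rabs_le_inv _ _ (HQ t)). pose proof (Rabs_le_inv _ _ (Hfu t)). lra.
Qed.

(** This bound depends on the attractor through B; in the energy estimates it appears only
    multiplied by the defect e. *)
Lemma norm2_grad_le (L B S phi : R) (f : coef) (n : nat) (c : coef) :
  H2_bounded L B c -> norm1 n c <= S -> norm2 n f <= phi ->
  norm2 n (grad L f n c) <= sqrt B + S * S * sqrt B + phi.
Proof.
  intros Hc HS Hf.
  assert (norm2 n (dx L (dx L c)) <= sqrt B /\ norm2 n c <= sqrt B) as [H1 H2].
  { destruct (Hc n) as [H1 H2].
    split; rewrite <- (sqrt_pow2 (norm2 n _)) by apply norm2_nonneg;
    apply sqrt_le_1_alt; assumption. }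
  pose proof (norm2_Cadd n (sub (dx L (dx L c)) (tri n c c c)) f) as N1.
  pose proof (norm2_Csub n (dx L (dx L c)) (tri n c c c)) as N2.
  pose proof (norm2_tri_le n c c c) as N3.
  assert (norm1 n c * norm1 n c * norm2 n c <= S * S * sqrt B).
  { pose proof (norm1_nonneg n c).
    apply Rmult_le_compat; [apply Rmult_le_pos; assumption|apply norm2_nonneg| |exact H2].
    apply Rmult_le_compat; assumption. }
  unfold sub in N1. unfold grad. lra.
Qed.

Lemma norm2_mono (n m : nat) (c : coef) : (n <= m)%nat -> norm2 n c <= norm2 m c.
Proof.
  intros H. apply sqrt_le_1_alt, sumZ_mono; [|exact H]. intros. apply pow2_ge_0.
Qed.

Lemma norm1_mono (n m : nat) (c : coef) : (n <= m)%nat -> norm1 n c <= norm1 m c.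
Proof. intros H. apply sumZ_mono; [|exact H]. intros. apply cmod_nonneg. Qed.

(* The point is that [S], unlike [B], depends only on L, gamma and |f|. *)
Lemma uniform_bounds (L gamma phi : R) : 0 < L -> 0 < gamma -> 0 <= phi ->
  exists S, 0 <= S /\ forall f u B,
    (forall n, norm2 n f <= phi) -> nls_complete_sol L gamma f u ->
    (forall t, H2_bounded L B (u t)) ->
    forall n t, norm1 n (u t) <= S /\ norm2 n (dx L (u t)) <= S.
Proof.
  intros HL Hg Hphi.
  destruct (H1_bound L gamma phi HL Hg Hphi) as [R1 [HR1 H1]].
  set (R0 := (phi + 1) / gamma).
  destruct (norm1_interp L 1 HL Rlt_0_1) as [C0 [HC0 HC]].
  exists (R1 + sqrt (C0 * R0 ^ 2 + 1 * R1 ^ 2)).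
  assert (Hs := sqrt_pos (C0 * R0 ^ 2 + 1 * R1 ^ 2)).
  split; [lra|]. intros f u B Hf Hu HB.
  destruct (norm1_le_H2 L B HL) as [S [HS0 HS]].
  set (G := sqrt B + S * S * sqrt B + phi).
  assert (HG0 : 0 <= G).
  { unfold G. pose proof (sqrt_pos B). assert (0 <= S * S) by nra.
    assert (0 <= S * S * sqrt B) by (apply Rmult_le_pos; assumption). lra. }
  (* Ensures e <= 1 and e G <= 1 at once. *)
  set (e := / (1 + G)).
  assert (He : 0 < e <= 1).
  { unfold e. split; [apply Rinv_0_lt_compat; lra|].
    rewrite <- Rinv_1. apply Rinv_le_contravar; lra. }
  assert (HeG : e * G <= 1).
  { apply Rmult_le_reg_l with (1 + G); [lra|]. unfold e.
    rewrite <- Rmult_assoc, Rinv_r by lra. lra. }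
  destruct (galerkin_approx L gamma B f u HL HB Hu e (proj1 He)) as [n0 Hn0].
  assert (HBt : forall n t, norm2 n (u t) ^ 2 <= B) by (intros n t; apply HB).
  assert (big : forall n, (n0 <= n)%nat -> forall t,
      norm2 n (u t) <= R0 /\ norm2 n (dx L (u t)) <= R1).
  { intros n Hn t. split.
    - eapply Rle_trans; [apply (L2_bound L gamma phi e B f n u); try lra; auto|].
      apply Rmult_le_compat_r; [apply Rlt_le, Rinv_0_lt_compat; exact Hg|lra].
    - apply (H1 f u n e G (B + S * S * B + phi * S)); auto; try lra.
      + intros s. apply norm2_grad_le; auto.
      + intros s. pose proof (HBt n s). pose proof (H2_bounded_nonneg _ _ _ (HB s)).
        assert (0 <= S * S) by nra. nra.
      + intros s. unfold energy. rewrite ip_self.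
        pose proof (norm2_dx_le_H2 L B (u s) n (HB s)).
        pose proof (Rabs_le_inv _ _ (Q_le n (u s) (u s) (u s) (u s))).
        pose proof (Rabs_le_inv _ _ (ip_le n f (u s))).
        pose proof (HS (u s) (HB s) n). pose proof (norm2_le_norm1 n (u s)).
        pose proof (norm2_nonneg n (u s)). pose proof (norm1_nonneg n (u s)).
        assert (norm2 n f * norm2 n (u s) <= phi * S)
          by (apply Rmult_le_compat; auto; [apply norm2_nonneg|lra]).
        assert (norm1 n (u s) * norm1 n (u s) * norm2 n (u s) * norm2 n (u s) <= S * S * B).
        { rewrite Rmult_assoc. apply Rmult_le_compat; try nra.
          apply Rle_trans with (norm2 n (u s) ^ 2); [right; ring|apply HBt]. }
        pose proof (pow2_ge_0 (norm2 n (dx L (u s)))).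
        pose proof (H2_bounded_nonneg _ _ _ (HB s)).
        assert (0 <= S * S * B) by (apply Rmult_le_pos; nra). lra. }
  (* The partial sums increase with n, so the bounds for large n hold for every n. *)
  intros n t. destruct (big (Nat.max n n0) ltac:(lia) t) as [K0 K1].
  split.
  - eapply Rle_trans; [apply (norm1_mono n (Nat.max n n0)); lia|].
    apply Rle_trans with (sqrt (C0 * R0 ^ 2 + 1 * R1 ^ 2)); [|lra].
    rewrite <- (sqrt_pow2 (norm1 _ _)) by apply norm1_nonneg.
    apply sqrt_le_1_alt. eapply Rle_trans; [apply HC|].
    apply Rplus_le_compat; apply Rmult_le_compat_l; try lra; apply pow_incr;
      (split; [apply norm2_nonneg|assumption]).
  - eapply Rle_trans; [apply (norm2_mono n (Nat.max n n0)); lia|]. lra.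
Qed.

(** * The difference of two trajectories *)

Lemma Q_le_bounds (n : nat) (a b c d : coef) (A B C0 D : R) :
  norm1 n a <= A -> norm1 n b <= B -> norm1 n c <= C0 -> norm2 n d <= D ->
  - (A * B * C0 * D) <= Q n a b c d <= A * B * C0 * D.
Proof.
  intros HA HB HC HD. apply Rabs_le_inv. eapply Rle_trans; [apply Q_le|].
  pose proof (norm1_nonneg n a). pose proof (norm1_nonneg n b).
  pose proof (norm2_nonneg n c). pose proof (norm2_nonneg n d).
  pose proof (norm2_le_norm1 n c).
  repeat apply Rmult_le_compat; try assumption; repeat apply Rmult_le_pos; try assumption. lra.
Qed.

(* Bregman-type remainder of the quartic functional Q/4 at v in direction u - v. *)
Definition bregman (n : nat) (u v : coef) : R :=
  / 4 * Q n u u u u - / 4 * Q n v v v v - Q n v v v (sub u v).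

Definition diff_energy (L : R) (n : nat) (u v : coef) : R :=
  / 2 * ip n (dx L (sub u v)) (dx L (sub u v)) - bregman n u v.

(** The pairing with z of the cubic map at v + w minus its first-order Taylor polynomial at v: three
    quadratic terms and one cubic term in w. *)
Definition quadr (n : nat) (v w z : coef) : R :=
  Q n w w v z + Q n w v w z + Q n v w w z + Q n w w w z.

(** The linear terms have cancelled: each of the six pairs of slots carries w twice, and 6/4 is the
    constant 3/2 of [bregman_le]. *)
Lemma bregman_expand (n : nat) (u v : coef) (w := sub u v) :
  bregman n u v = / 4 * (Q n w w u u + Q n w v w u + Q n w v v w
                         + Q n v w w u + Q n v w v w + Q n v v w w).
Proof.
  unfold bregman, w. rewrite ?Q_sub1, ?Q_sub2, ?Q_sub3, ?Q_sub4.
  assert (E : forall x, Q n x v v v = Q n v v v x).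
  { intros x. rewrite (Q_conj n x), (Q_swap24 n v x). reflexivity. }
  assert (E2 : forall x, Q n v x v v = Q n v v v x) by (intros x; apply Q_swap24).
  assert (E3 : forall x, Q n v v x v = Q n v v v x) by (intros x; apply Q_conj).
  rewrite ?(E u), ?(E2 u), ?(E3 u). field.
Qed.

Lemma bregman_le (n : nat) (u v : coef) (S : R) :
  norm1 n u <= S -> norm1 n v <= S ->
  - (3 / 2 * S ^ 2 * norm1 n (sub u v) ^ 2) <= bregman n u v
  <= 3 / 2 * S ^ 2 * norm1 n (sub u v) ^ 2.
Proof.
  intros Hu Hv. rewrite bregman_expand. set (w := sub u v). set (W := norm1 n w).
  assert (Hw : norm1 n w <= W) by apply Rle_refl.
  assert (Hw2 : norm2 n w <= W) by apply norm2_le_norm1.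
  assert (Hu2 : norm2 n u <= S) by (eapply Rle_trans; [apply norm2_le_norm1|exact Hu]).
  pose proof (Q_le_bounds n w w u u W W S S Hw Hw Hu Hu2).
  pose proof (Q_le_bounds n w v w u W S W S Hw Hv Hw Hu2).
  pose proof (Q_le_bounds n w v v w W S S W Hw Hv Hv Hw2).
  pose proof (Q_le_bounds n v w w u S W W S Hv Hw Hw Hu2).
  pose proof (Q_le_bounds n v w v w S W S W Hv Hw Hv Hw2).
  pose proof (Q_le_bounds n v v w w S S W W Hv Hv Hw Hw2).
  split; lra.
Qed.

Lemma path_deriv_sub (n : nat) (u v : R -> coef) (t : R) (du dv : coef) :
  path_deriv n u t du -> path_deriv n v t dv ->
  path_deriv n (fun s => sub (u s) (v s)) t (sub du dv).
Proof. intros Hu Hv k Hk. apply (cderiv_Csub (fun s => u s k) (fun s => v s k)); auto. Qed.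

(** Write F for Q/4. By symmetry of the Hessian the derivative of the remainder is the pairing of
    F'(u) - F'(v) with w' plus that of F'(u) - F'(v) - F''(v) w with v'. The first completes the
    difference of gradients, where f cancels; the second is [quadr]. *)
Lemma diff_energy_derivable (L : R) (f : coef) (n : nat) (u v : R -> coef) (t : R) (du dv : coef) :
  path_deriv n u t du -> path_deriv n v t dv ->
  derivable_pt_lim (fun s => diff_energy L n (u s) (v s)) t
    (ip n (sub (grad L f n (u t)) (grad L f n (v t))) (sub du dv)
     - quadr n (v t) (sub (u t) (v t)) dv).
Proof.
  intros Hu Hv. unfold diff_energy, bregman.
  pose proof (path_deriv_sub n u v t du dv Hu Hv) as Hw.
  pose proof (path_deriv_dx L n (fun s => sub (u s) (v s)) t _ Hw) as Hx.
  eapply derivable_pt_lim_eq.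
  - apply (derivable_pt_lim_minus
      (fun s => / 2 * ip n (dx L (sub (u s) (v s))) (dx L (sub (u s) (v s))))
      (fun s => / 4 * Q n (u s) (u s) (u s) (u s) - / 4 * Q n (v s) (v s) (v s) (v s)
                - Q n (v s) (v s) (v s) (sub (u s) (v s)))).
    + apply (derivable_pt_lim_scal
        (fun s => ip n (dx L (sub (u s) (v s))) (dx L (sub (u s) (v s))))).
      apply (ip_derivable n (fun s => dx L (sub (u s) (v s)))
               (fun s => dx L (sub (u s) (v s))) t); exact Hx.
    + apply (derivable_pt_lim_minus
        (fun s => / 4 * Q n (u s) (u s) (u s) (u s) - / 4 * Q n (v s) (v s) (v s) (v s))
        (fun s => Q n (v s) (v s) (v s) (sub (u s) (v s)))).
      * apply (derivable_pt_lim_minus (fun s => / 4 * Q n (u s) (u s) (u s) (u s))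
                 (fun s => / 4 * Q n (v s) (v s) (v s) (v s)));
        apply Q_derivable_diag; [exact Hu|exact Hv].
      * apply (Q_derivable n v v v (fun s => sub (u s) (v s)) t); try exact Hv. exact Hw.
  - set (w := sub (u t) (v t)). set (dw := sub du dv).
    rewrite (ip_comm n (dx L dw) (dx L w)).
    rewrite ip_sub_l, !ip_grad.
    assert (ip n (dx L w) (dx L dw)
            = ip n (dx L (u t)) (dx L dw) + -1 * ip n (dx L (v t)) (dx L dw)) as ->
      by (unfold w; ip_ext; ring).
    rewrite (Q_conj n dv (v t) (v t) w), (Q_swap13 n (v t) dv w (v t)),
      (Q_swap24 n w dv (v t) (v t)).
    rewrite (Q_swap24 n (v t) dv (v t) w), (Q_conj n (v t) (v t) dv w).
    unfold quadr, w, dw. rewrite ?Q_sub1, ?Q_sub2, ?Q_sub3, ?Q_sub4.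
    rewrite ?Q_sub1, ?Q_sub2, ?Q_sub3, ?Q_sub4. field.
Qed.

Lemma cmod_rot (z : C) : cmod (rot z) = cmod z.
Proof. unfold cmod. f_equal. unfold rot, Cnorm2. simpl. ring. Qed.

Lemma norm2_dx_rotc (L : R) (n : nat) (c : coef) : norm2 n (dx L (rotc c)) = norm2 n (dx L c).
Proof.
  rewrite !norm2_dx. unfold rotc, l2. f_equal. apply sumZ_ext. intros. rewrite cmod_rot. reflexivity.
Qed.

(* The H^2 part of the velocity is -i times minus the second derivative; the rest is bounded in L^2. *)
Lemma velocity_regular_part (L gamma phi S : R) (f : coef) (n : nat) (v r : coef) :
  0 < gamma -> norm1 n v <= S -> norm2 n f <= phi -> norm2 n r <= 1 ->
  norm2 n (sub (dx L (dx L (rotc v))) (velocity gamma v (grad L f n v) r))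
  <= gamma * S + S ^ 3 + phi + 1.
Proof.
  intros Hg Hv Hf Hr.
  replace (sub (dx L (dx L (rotc v))) (velocity gamma v (grad L f n v) r))
    with (fun k => Cadd (Cadd (cscal gamma (v k)) (rotc (tri n v v v) k))
                        (Csub (rotc r k) (rotc f k))).
  2:{ extensionality k. unfold sub, dx, velocity, grad, rotc, rot, cscal, Cadd, Csub.
      cbn -[tri]. f_equal; ring. }
  pose proof (norm2_Cadd n (fun k => Cadd (cscal gamma (v k)) (rotc (tri n v v v) k))
                (fun k => Csub (rotc r k) (rotc f k))) as N1.
  pose proof (norm2_Cadd n (fun k => cscal gamma (v k)) (rotc (tri n v v v))) as N2.
  pose proof (norm2_Csub n (rotc r) (rotc f)) as N3.
  rewrite !norm2_rotc in *.
  assert (N4 : norm2 n (fun k => cscal gamma (v k)) = gamma * norm2 n v).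
  { transitivity (Rabs gamma * norm2 n v); [|rewrite Rabs_pos_eq by lra; reflexivity].
    unfold norm2. rewrite <- l2_scal.
    unfold l2. f_equal. apply sumZ_ext. intros.
    rewrite cmod_cscal, !Rpow_mult_distr, pow2_abs. reflexivity. }
  pose proof (norm2_le_norm1 n v). pose proof (norm1_nonneg n v). pose proof (norm2_nonneg n v).
  assert (gamma * norm2 n v <= gamma * S) by (apply Rmult_le_compat_l; lra).
  assert (norm1 n v * norm1 n v * norm2 n v <= S ^ 3).
  { replace (S ^ 3) with (S * S * S) by ring.
    apply Rmult_le_compat; try lra; [apply Rmult_le_pos; lra|apply Rmult_le_compat; lra]. }
  pose proof (norm2_tri_le n v v v). lra.
Qed.

Lemma Q_dxx_le_bounds (L : R) (n : nat) (a b c d : coef) (A B C0 A' B' C' D : R) :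
  norm1 n a <= A -> norm1 n b <= B -> norm1 n c <= C0 ->
  norm2 n (dx L a) <= A' -> norm2 n (dx L b) <= B' -> norm2 n (dx L c) <= C' ->
  norm2 n (dx L d) <= D ->
  Rabs (Q n a b c (dx L (dx L d))) <= A' * B * C0 * D + A * B' * C0 * D + A * B * C' * D.
Proof.
  intros HA HB HC HA' HB' HC' HD. eapply Rle_trans; [apply Q_dxx_le|].
  pose proof (norm1_nonneg n a). pose proof (norm1_nonneg n b). pose proof (norm1_nonneg n c).
  pose proof (norm2_nonneg n (dx L a)). pose proof (norm2_nonneg n (dx L b)).
  pose proof (norm2_nonneg n (dx L c)). pose proof (norm2_nonneg n (dx L d)).
  repeat apply Rplus_le_compat; repeat apply Rmult_le_compat;
    repeat apply Rmult_le_pos; assumption.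
Qed.

(** The velocity is split into its second-derivative part h and an L^2-bounded part -z. For h,
    [Q_dxx_le] shifts one derivative, so only |v_x| and |w_x| occur. The bound W <= 2 S reduces the
    cubic term in w to the quadratic ones. *)
Lemma quadr_velocity_le (L gamma phi S : R) (f : coef) (n : nat) (v w r : coef)
  (W := norm1 n w) (Y := norm2 n (dx L w)) (D := gamma * S + S ^ 3 + phi + 1) :
  0 < gamma -> norm1 n v <= S -> norm2 n (dx L v) <= S -> W <= 2 * S ->
  norm2 n f <= phi -> norm2 n r <= 1 ->
  - quadr n v w (velocity gamma v (grad L f n v) r)
  <= (12 * S ^ 2) * (Y * W) + (3 * S ^ 2 + 5 * S * D) * W ^ 2.
Proof.
  intros Hg Hv Hvx HW Hf Hr.
  set (d := velocity gamma v (grad L f n v) r).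
  pose proof (velocity_regular_part L gamma phi S f n v r Hg Hv Hf Hr) as Hz.
  set (h := dx L (dx L (rotc v))) in *. fold d in Hz. set (z := sub h d) in *. fold D in Hz.
  assert (Ed : forall a b c, Q n a b c d = Q n a b c h - Q n a b c z)
    by (intros; unfold z; rewrite Q_sub4; ring).
  assert (Hw : norm1 n w <= W) by apply Rle_refl.
  assert (Hwx : norm2 n (dx L w) <= Y) by apply Rle_refl.
  assert (HW0 : 0 <= W) by apply norm1_nonneg.
  assert (HY0 : 0 <= Y) by apply norm2_nonneg.
  assert (HS0 : 0 <= S) by lra.
  assert (Hrx : norm2 n (dx L (rotc v)) <= S) by (rewrite norm2_dx_rotc; exact Hvx).
  unfold quadr. rewrite !Ed.
  pose proof (Q_le_bounds n w w v z W W S D Hw Hw Hv Hz).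
  pose proof (Q_le_bounds n w v w z W S W D Hw Hv Hw Hz).
  pose proof (Q_le_bounds n v w w z S W W D Hv Hw Hw Hz).
  pose proof (Q_le_bounds n w w w z W W (2 * S) D Hw Hw HW Hz).
  pose proof (Rabs_le_inv _ _ (Q_dxx_le_bounds L n w w v (rotc v) W W S Y Y S S Hw Hw Hv Hwx Hwx Hvx Hrx)) as X1.
  pose proof (Rabs_le_inv _ _ (Q_dxx_le_bounds L n w v w (rotc v) W S W Y S Y S Hw Hv Hw Hwx Hvx Hwx Hrx)) as X2.
  pose proof (Rabs_le_inv _ _ (Q_dxx_le_bounds L n v w w (rotc v) S W W S Y Y S Hv Hw Hw Hvx Hwx Hwx Hrx)) as X3.
  pose proof (Rabs_le_inv _ _ (Q_dxx_le_bounds L n w w w (rotc v) W W W Y Y Y S Hw Hw Hw Hwx Hwx Hwx Hrx)) as X4.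
  fold h in X1, X2, X3, X4.
  assert (W * (W * Y * S) <= 2 * S * (W * Y * S))
    by (apply Rmult_le_compat_r; [repeat apply Rmult_le_pos; assumption|exact HW]).
  lra.
Qed.

Lemma difference_bound (L gamma phi S : R) : 0 < gamma -> 0 <= phi -> 0 <= S ->
  exists theta, 0 < theta /\ forall f u v n e G,
    0 <= e <= 1 -> norm2 n f <= phi ->
    galerkin L gamma f n u e -> galerkin L gamma f n v e ->
    (forall t, norm2 n (grad L f n (u t)) <= G) -> (forall t, norm2 n (grad L f n (v t)) <= G) ->
    (forall t, norm1 n (u t) <= S /\ norm2 n (dx L (u t)) <= S) ->
    (forall t, norm1 n (v t) <= S /\ norm2 n (dx L (v t)) <= S) ->
    (forall t, norm1 n (sub (u t) (v t)) <= theta * norm2 n (dx L (sub (u t) (v t)))) ->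
    forall t, norm2 n (dx L (sub (u t) (v t))) ^ 2 <= 32 * G * e / gamma.
Proof.
  intros Hg Hphi HS.
  set (D := gamma * S + S ^ 3 + phi + 1).
  assert (HS2 : 0 <= S ^ 2) by apply pow2_ge_0.
  assert (HS3 : 0 <= S ^ 3) by (apply pow_le; exact HS).
  assert (HD : 0 <= D) by (unfold D; nra).
  (* Total coefficient of theta |w_x|^2 in the derivative: 3 gamma S^2 from the damping, 12 S^2 + 3
     S^2 + 5 S D from [quadr_velocity_le]. *)
  set (K := 3 * gamma * S ^ 2 + 15 * S ^ 2 + 5 * S * D).
  assert (HK : 0 <= K) by (unfold K; assert (0 <= gamma * S ^ 2) by nra; assert (0 <= S * D) by nra; lra).
  (* One summand for each requirement on theta: theta K <= gamma / 2, theta <= 1 and theta S^2 <=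
     1/6. The last one bounds the remainder by |w_x|^2 / 4, so that the energy is at least |w_x|^2 /
     4. *)
  set (den := 2 * K + gamma * (1 + 6 * S ^ 2)).
  assert (Hden : 0 < den) by (unfold den; nra).
  set (theta := gamma / den).
  assert (Hth : 0 < theta) by (apply Rdiv_lt_0_compat; assumption).
  assert (Eth : theta * den = gamma) by (unfold theta; field; lra).
  assert (Hp : 0 <= theta * K /\ 0 <= theta * S ^ 2) by (split; apply Rmult_le_pos; lra).
  unfold den in Eth.
  assert (T1 : theta <= 1).
  { apply Rmult_le_reg_l with gamma; [exact Hg|]. nra. }
  assert (T2 : theta * K <= gamma / 2) by nra.
  assert (T3 : theta * S ^ 2 <= / 6).
  { apply Rmult_le_reg_l with gamma; [exact Hg|]. nra. }
  exists theta. split; [exact Hth|].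
  intros f u v n e G [He0 He1] Hf Hu Hv HGu HGv HSu HSv Hw t.
  assert (HW2 : forall t, norm1 n (sub (u t) (v t)) ^ 2
      <= theta * norm2 n (dx L (sub (u t) (v t))) ^ 2).
  { intros s. pose proof (norm1_nonneg n (sub (u s) (v s))).
    apply Rle_trans with ((theta * norm2 n (dx L (sub (u s) (v s)))) ^ 2).
    - apply pow_incr. split; [assumption|apply Hw].
    - pose proof (pow2_ge_0 (norm2 n (dx L (sub (u s) (v s))))).
      assert (0 <= theta * norm2 n (dx L (sub (u s) (v s))) ^ 2) by (apply Rmult_le_pos; lra). nra. }
  assert (HB : forall t, - (/ 4 * norm2 n (dx L (sub (u t) (v t))) ^ 2) <= bregman n (u t) (v t)
      <= / 4 * norm2 n (dx L (sub (u t) (v t))) ^ 2).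
  { intros s. pose proof (bregman_le n (u s) (v s) S (proj1 (HSu s)) (proj1 (HSv s))).
    pose proof (Rmult_le_compat_l _ _ _ HS2 (HW2 s)).
    pose proof (Rmult_le_compat_r _ _ _ (pow2_ge_0 (norm2 n (dx L (sub (u s) (v s))))) T3). lra. }
  assert (HG0 : 0 <= G) by (eapply Rle_trans; [apply norm2_nonneg|apply (HGu 0)]).
  assert (HE : forall t, diff_energy L n (u t) (v t) <= (4 * G * e) / (gamma / 2)).
  2:{ specialize (HE t). unfold diff_energy in HE. rewrite ip_self in HE. specialize (HB t).
      replace (32 * G * e / gamma) with (4 * (4 * G * e / (gamma / 2))) by (field; lra). lra. }
  clear t.
  (* The a priori bound is 3/4 |w_x|^2 with |w_x| <= 2 S; the source 4 G e pairs a gradient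
     difference <= 2 G with a defect difference <= 2 e. *)
  apply (gronwall_line _ (gamma / 2) (4 * G * e) (3 * S ^ 2)); [lra| |].
  2:{ intros s. unfold diff_energy. rewrite ip_self. specialize (HB s).
      assert (norm2 n (dx L (sub (u s) (v s))) <= 2 * S).
      { replace (dx L (sub (u s) (v s))) with (sub (dx L (u s)) (dx L (v s))).
        - eapply Rle_trans; [apply norm2_Csub|]. pose proof (HSu s). pose proof (HSv s). lra.
        - extensionality k. unfold sub, dx, cscal, Csub. simpl. f_equal; ring. }
      pose proof (norm2_nonneg n (dx L (sub (u s) (v s)))).
      assert (norm2 n (dx L (sub (u s) (v s))) ^ 2 <= (2 * S) ^ 2) by (apply pow_incr; lra). lra. }
  intros t. destruct (Hu t) as [r1 [Hr1 Hd1]]. destruct (Hv t) as [r2 [Hr2 Hd2]].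
  eexists. split; [apply (diff_energy_derivable L f n u v t _ _ Hd1 Hd2)|].
  destruct (HSu t) as [HUt _]. destruct (HSv t) as [HVt HVxt].
  specialize (HB t). specialize (HW2 t). specialize (Hw t). specialize (HGu t). specialize (HGv t).
  set (gu := grad L f n (u t)) in *. set (gv := grad L f n (v t)) in *.
  set (w := sub (u t) (v t)) in *. set (h := sub gu gv).
  (* The velocity is linear in its arguments, so w obeys an equation of the same form with h in
     place of the gradient; then h is orthogonal to [rotc h]. *)
  assert (E : sub (velocity gamma (u t) gu r1) (velocity gamma (v t) gv r2)
              = velocity gamma w h (sub r1 r2)).
  { extensionality k. unfold w, h, sub, velocity, rot, cscal, Cadd, Csub. simpl. f_equal; ring. }
  rewrite E, ip_velocity, ip_rotc_self.
  assert (HWS : norm1 n w <= 2 * S) by (eapply Rle_trans; [apply norm1_Csub|lra]).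
  pose proof (quadr_velocity_le L gamma phi S f n (v t) w r2 Hg HVt HVxt HWS Hf ltac:(lra)) as HR.
  fold gv D in HR.
  assert (Hh : Rabs (ip n h (rotc (sub r1 r2))) <= 4 * G * e).
  { eapply Rle_trans; [apply ip_rotc_le|].
    replace (4 * G * e) with ((2 * G) * (2 * e)) by ring.
    apply Rmult_le_compat; try apply norm2_nonneg; (eapply Rle_trans; [apply norm2_Csub|lra]). }
  apply Rabs_le_inv in Hh.
  (* The cubic terms are telescoped, replacing u by v one slot at a time, so each term contains w
     twice. *)
  assert (Eh : ip n h w = norm2 n (dx L w) ^ 2
     - (Q n w (u t) (u t) w + Q n (v t) w (u t) w + Q n (v t) (v t) w w)).
  { unfold h. rewrite ip_sub_l. unfold gu, gv. rewrite !ip_grad, <- ip_self.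
    assert (ip n (dx L w) (dx L w)
            = ip n (dx L (u t)) (dx L w) + -1 * ip n (dx L (v t)) (dx L w)) as ->
      by (unfold w; ip_ext; ring).
    assert (forall x y z, Q n w x y z = Q n (u t) x y z - Q n (v t) x y z) as F1
      by (intros; apply Q_sub1).
    assert (forall x y z, Q n x w y z = Q n x (u t) y z - Q n x (v t) y z) as F2
      by (intros; apply Q_sub2).
    assert (forall x y z, Q n x y w z = Q n x y (u t) z - Q n x y (v t) z) as F3
      by (intros; apply Q_sub3).
    rewrite (F1 (u t) (u t) w), (F2 (v t) (u t) w), (F3 (v t) (v t) w). ring. }
  rewrite Eh. unfold diff_energy. fold w. rewrite ip_self.
  set (W := norm1 n w) in *. set (Y := norm2 n (dx L w)) in *.
  assert (Hw1 : norm1 n w <= W) by apply Rle_refl.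
  assert (Hw2 : norm2 n w <= W) by apply norm2_le_norm1.
  pose proof (Q_le_bounds n w (u t) (u t) w W S S W Hw1 HUt HUt Hw2).
  pose proof (Q_le_bounds n (v t) w (u t) w S W S W HVt Hw1 HUt Hw2).
  pose proof (Q_le_bounds n (v t) (v t) w w S S W W HVt HVt Hw1 Hw2).
  set (q := Q n w (u t) (u t) w + Q n (v t) w (u t) w + Q n (v t) (v t) w w) in *.
  assert (Hq : gamma * q <= gamma * (3 * S ^ 2 * W ^ 2))
    by (apply Rmult_le_compat_l; [lra|unfold q; lra]).
  assert (HY0 : 0 <= Y) by apply norm2_nonneg.
  assert (HYW : Y * W <= theta * Y ^ 2) by nra.
  assert (H12 : 12 * S ^ 2 * (Y * W) <= 12 * S ^ 2 * (theta * Y ^ 2))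
    by (apply Rmult_le_compat_l; lra).
  assert (Hco : 0 <= 3 * gamma * S ^ 2 + 3 * S ^ 2 + 5 * S * D).
  { assert (0 <= gamma * S ^ 2) by nra. assert (0 <= S * D) by nra. lra. }
  pose proof (Rmult_le_compat_l _ _ _ Hco HW2) as H13.
  pose proof (Rmult_le_compat_r _ _ _ (pow2_ge_0 Y) T2) as H14. unfold K in H14.
  assert (H15 : gamma / 2 * (- bregman n (u t) (v t)) <= gamma / 2 * (/ 4 * Y ^ 2))
    by (apply Rmult_le_compat_l; lra).
  assert (H16 : 0 <= gamma * Y ^ 2) by (apply Rmult_le_pos; [lra|apply pow2_ge_0]).
  lra.
Qed.

(** * Choice of the threshold and conclusion *)

Lemma norm2_le_L2_norm (L nf : R) (f : coef) : 0 < L -> L2_norm_is L f nf ->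
  forall n, norm2 n f <= nf / sqrt L.
Proof.
  intros HL [Hnf Hcv] n.
  assert (Hs : 0 < sqrt L) by (apply sqrt_lt_R0; exact HL).
  apply pow2_le_inv; [apply Rmult_le_pos; [exact Hnf|apply Rlt_le, Rinv_0_lt_compat; exact Hs]|].
  assert (H : L2_partial L f n <= nf ^ 2).
  { apply (growing_ineq (L2_partial L f)); [|exact Hcv].
    intros j. unfold L2_partial. apply Rmult_le_compat_l; [lra|].
    apply sumZ_mono; [intros; apply Cnorm2_nonneg|lia]. }
  unfold L2_partial in H. rewrite <- norm2_sq in H.
  replace ((nf / sqrt L) ^ 2) with (nf ^ 2 / L).
  2:{ unfold Rdiv. rewrite Rpow_mult_distr, pow_inv, pow2_sqrt by lra. reflexivity. }
  apply Rmult_le_reg_l with L; [exact HL|].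
  replace (L * (nf ^ 2 / L)) with (nf ^ 2) by (field; lra). exact H.
Qed.

Lemma high_modes_vanish (L gamma phi : R) : 0 < L -> 0 < gamma -> 0 <= phi ->
  exists M, 0 <= M /\ forall (f : coef) (A : coef -> Prop) (m : nat) (u v : R -> coef),
    (forall n, norm2 n f <= phi) -> H2_compact L A -> M + 1 <= INR m ->
    complete_traj_in L gamma f A u -> complete_traj_in L gamma f A v ->
    (forall t, Pm_eq m (u t) (v t)) -> forall t, u t = v t.
Proof.
  intros HL Hg Hphi.
  pose proof (lam_pos L HL) as Hl.
  destruct (uniform_bounds L gamma phi HL Hg Hphi) as [S [HS0 HS]].
  destruct (difference_bound L gamma phi S Hg Hphi HS0) as [theta [Hth Hdiff]].
  set (lam := 2 * PI / L) in *.
  assert (Htl : 0 < theta * lam) by (apply Rmult_lt_0_compat; assumption).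
  assert (HM0 : 0 < 2 / (theta * lam) ^ 2) by (apply Rdiv_lt_0_compat; [lra|apply pow_lt; exact Htl]).
  (* Above this value of m the tail constant sqrt(2/m) / lam is at most theta. The additional 1 in M
     + 1 guarantees m >= 1. *)
  exists (2 / (theta * lam) ^ 2). split; [lra|].
  intros f A m u v Hf HA Hm [Hu HAu] [Hv HAv] Hlow t.
  assert (Hm1 : (1 <= m)%nat) by (apply INR_le; change (INR 1) with 1; lra).
  assert (Hmth : sqrt (2 / INR m) / lam <= theta).
  { apply Rmult_le_reg_r with lam; [exact Hl|].
    unfold Rdiv at 1. rewrite Rmult_assoc, Rinv_l, Rmult_1_r by lra.
    rewrite <- (sqrt_pow2 (theta * lam)) by lra. apply sqrt_le_1_alt.
    assert (P2 : 0 < (theta * lam) ^ 2) by (apply pow_lt; exact Htl).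
    assert (E : 2 / (theta * lam) ^ 2 * (theta * lam) ^ 2 = 2)
      by (unfold Rdiv; rewrite Rmult_assoc, Rinv_l; lra).
    apply Rmult_le_reg_r with (INR m); [lra|].
    unfold Rdiv at 1. rewrite Rmult_assoc, Rinv_l by lra.
    apply Rmult_le_compat_r with (r := (theta * lam) ^ 2) in Hm; lra. }
  destruct (H2_compact_bounded L A HL HA) as [M HM].
  assert (HBu : forall t, H2_bounded L (M / L) (u t))
    by (intros s; apply H2_bounded_of_partial; auto).
  assert (HBv : forall t, H2_bounded L (M / L) (v t))
    by (intros s; apply H2_bounded_of_partial; auto).
  pose proof (HS f u _ Hf Hu HBu) as HSu. pose proof (HS f v _ Hf Hv HBv) as HSv.
  set (G := sqrt (M / L) + S * S * sqrt (M / L) + phi).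
  assert (HG : 0 <= G).
  { unfold G. pose proof (sqrt_pos (M / L)). assert (0 <= S * S) by nra.
    assert (0 <= S * S * sqrt (M / L)) by (apply Rmult_le_pos; assumption). lra. }
  (* The left side involves neither e nor the truncation level n, which is chosen after e; this is
     where the defect can be sent to 0. *)
  assert (small : forall k e, 0 < e <= 1 ->
      freq L k ^ 2 * Cnorm2 (sub (u t) (v t) k) <= 32 * G * e / gamma).
  { intros k e He.
    destruct (galerkin_approx L gamma _ f u HL HBu Hu e (proj1 He)) as [n1 Hn1].
    destruct (galerkin_approx L gamma _ f v HL HBv Hv e (proj1 He)) as [n2 Hn2].
    set (n := Nat.max (Z.abs_nat k) (Nat.max n1 n2)).
    eapply Rle_trans; [|apply (Hdiff f u v n e G)]; auto.
    - rewrite norm2_dx_sq.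
      apply (sumZ_term n (fun k => freq L k ^ 2 * Cnorm2 (sub (u t) (v t) k))); [|lia].
      intros j. apply Rmult_le_pos; [apply pow2_ge_0|apply Cnorm2_nonneg].
    - lra.
    - apply Hn1. lia.
    - apply Hn2. lia.
    - intros s. apply norm2_grad_le; [apply HBu|apply HSu|apply Hf].
    - intros s. apply norm2_grad_le; [apply HBv|apply HSv|apply Hf].
    - intros s. eapply Rle_trans; [apply (norm1_tail_le L m); auto|].
      + intros j Hj. unfold sub. rewrite (Hlow s j Hj). unfold Csub. f_equal; ring.
      + apply Rmult_le_compat_r; [apply norm2_nonneg|exact Hmth]. }
  extensionality k.
  (* The low modes agree by hypothesis. This includes k = 0, where the frequency vanishes and
     [small] gives nothing. *)
  destruct (Z.le_gt_cases (Z.abs k) (Z.of_nat m)) as [h|h]; [apply Hlow; exact h|].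
  assert (Hk : 0 < freq L k ^ 2).
  { rewrite freq_mult. fold lam. rewrite Rpow_mult_distr.
    assert (IZR k <> 0) by (apply not_0_IZR; lia).
    apply Rmult_lt_0_compat; [apply pow_lt; exact Hl|].
    pose proof (Rsqr_pos_lt _ H). rewrite Rsqr_pow2 in *. assumption. }
  pose proof (Cnorm2_nonneg (sub (u t) (v t) k)) as Hc0.
  assert (Hc : Cnorm2 (sub (u t) (v t) k) = 0).
  { destruct Hc0 as [Hc0|Hc0]; [exfalso|auto].
    set (x := freq L k ^ 2 * Cnorm2 (sub (u t) (v t) k)) in *.
    assert (Hx : 0 < x) by (apply Rmult_lt_0_compat; assumption).
    (* Chosen so that 32 G e < x gamma and e <= 1. *)
    set (e := x * gamma / (32 * G + x * gamma + 1)).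
    assert (Hxg : 0 < x * gamma) by (apply Rmult_lt_0_compat; assumption).
    assert (Ee : e * (32 * G + x * gamma + 1) = x * gamma) by (unfold e; field; lra).
    assert (He : 0 < e <= 1).
    { split; [apply Rdiv_lt_0_compat; lra|].
      apply Rmult_le_reg_r with (32 * G + x * gamma + 1); lra. }
    specialize (small k e He). fold x in small.
    apply Rmult_le_compat_r with (r := gamma) in small; [|lra].
    replace (32 * G * e / gamma * gamma) with (32 * G * e) in small by (field; lra). nra. }
  unfold Cnorm2, sub, Csub in Hc. simpl fst in Hc. simpl snd in Hc.
  pose proof (pow2_ge_0 (fst (u t k) - fst (v t k))).
  pose proof (pow2_ge_0 (snd (u t k) - snd (v t k))).
  assert (E1 : fst (u t k) - fst (v t k) = 0) by (apply Rsqr_0_uniq; rewrite Rsqr_pow2; lra).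
  assert (E2 : snd (u t k) - snd (v t k) = 0) by (apply Rsqr_0_uniq; rewrite Rsqr_pow2; lra).
  destruct (u t k), (v t k). simpl in *. f_equal; lra.
Qed.

Theorem theorem3p1 :
  exists K11 : R -> R -> R -> R,
    (forall gamma nf L, 0 < K11 gamma nf L) /\
    forall (L gamma : R) (f : coef) (nf : R),
      0 < L -> 0 < gamma ->
      in_L2 L f -> (exists k, f k <> (0, 0)) -> L2_norm_is L f nf ->
      forall A : coef -> Prop, nls_global_attractor L gamma f A ->
      forall m : nat, INR m >= L / (2 * PI) * K11 gamma nf L - 1 ->
      forall u1 u2 : R -> coef,
        complete_traj_in L gamma f A u1 -> complete_traj_in L gamma f A u2 ->
        (forall t, Pm_eq m (u1 t) (u2 t)) ->
        forall t, u1 t = u2 t.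
Proof.
  (* The constant is produced for each triple of numbers before f and A are introduced, so that
     choice makes it a function of gamma, |f| and L. *)
  assert (H : forall gamma nf L, exists K, 0 < K /\
    forall f : coef, 0 < L -> 0 < gamma -> L2_norm_is L f nf ->
      forall A : coef -> Prop, H2_compact L A ->
      forall m : nat, INR m >= L / (2 * PI) * K - 1 ->
      forall u1 u2 : R -> coef,
        complete_traj_in L gamma f A u1 -> complete_traj_in L gamma f A u2 ->
        (forall t, Pm_eq m (u1 t) (u2 t)) ->
        forall t, u1 t = u2 t).
  { intros gamma nf L.
    destruct (classic (0 < L /\ 0 < gamma /\ 0 <= nf)) as [[HL [Hg Hnf]]|Hn].
    (* Default value for inadmissible parameters, since [K11] must be positive everywhere. *)
    2:{ exists 1. split; [lra|]. intros f HL Hg [Hnf _]. tauto. }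
    assert (Hphi : 0 <= nf / sqrt L).
    { apply Rmult_le_pos; [exact Hnf|]. apply Rlt_le, Rinv_0_lt_compat, sqrt_lt_R0, HL. }
    destruct (high_modes_vanish L gamma (nf / sqrt L) HL Hg Hphi) as [M [HM0 HM]].
    (* Makes L / (2 PI) * K - 1 equal to M + 1. *)
    exists (2 * PI / L * (M + 2)). split.
    { apply Rmult_lt_0_compat; [apply lam_pos, HL|lra]. }
    intros f _ _ Hf A HA m Hm u1 u2 H1 H2 Heq.
    apply (HM f A m u1 u2); auto.
    - apply norm2_le_L2_norm; assumption.
    - replace (L / (2 * PI) * (2 * PI / L * (M + 2))) with (M + 2) in Hm; [lra|].
      field. pose proof PI_RGT_0. split; lra. }
  set (K11 := fun gamma nf L => proj1_sig (constructive_indefinite_description _ (H gamma nf L))).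
  assert (HK := fun gamma nf L => proj2_sig (constructive_indefinite_description _ (H gamma nf L))).
  exists K11. split; [intros; apply HK|].
  intros L gamma f nf HL Hg _ _ Hf A [HA _]. exact (proj2 (HK gamma nf L) f HL Hg Hf A HA).
Qed.
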